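(* Let $J\subset\mathbb{R}$ be an open interval containing $t_0$, let $\theta_0\in\mathbb{R}$, let $N\ge 0$ be an integer, and let $$\mathrm{d}\mu(\theta;t)=\omega(\theta;t)\,\mathrm{d}\mu(\theta)+\sum_{j=0}^{N}\gamma_j(t)\,\delta(\theta-\omega_j(t))$$ be a finite nonnegative measure on the unit circle parametrized by $z=e^{i\theta}$ $(\theta\in[\theta_0,\theta_0+2\pi))$ and depending on a parameter $t$ varying in $J$. Suppose that $\gamma_j(t)$ and $\omega_j(t)$ are differentiable functions of $t$, and that, for almost all $\theta\in[\theta_0,\theta_0+2\pi)$, the function $\omega(\theta;t)$ is finite and admits partial derivative with respect to $t$, and that there exists a $\mu(\theta)$-integrable function $\alpha$ such that $$\left|\frac{\partial\omega}{\partial t}(\theta;t)\right|\le\alpha(\theta)$$ almost everywhere in $[\theta_0,\theta_0+2\pi)$. Let $P(\cdot;t)$ be a nonconstant monic paraorthogonal polynomial on the unit circle (POPUC), of degree $n$, associated with $\mathrm{d}\mu(\theta;t)$. Assume that $P(\zeta_0;t_0)=0$. (1) There exist $\epsilon>0$ and $\delta>0$, and a unique function $\zeta:I_\epsilon(t_0)\to C_\delta(\zeta_0)$, differentiable on $I_\epsilon(t_0)$, with $\zeta(t_0)=\zeta_0$, and such that $P(\zeta(t);t)=0$ for each $t\in I_\epsilon(t_0)$. (2) Assume moreover that $P(e^{i\theta_0};t)=0$ for each $t\in I_\epsilon(t_0)$, with $\zeta_0\ne e^{i\theta_0}$. Denote the zeros of $P(\cdot;t)$ by $\zeta_k(t)=e^{i\varphi_k(t)}$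 $(k=1,\dots,n)$, where we set $\theta_0=\varphi_{n-1}(t)$ and $\varphi(t)=\varphi_n(t)$, with $\zeta(t)=e^{i\varphi(t)}$, and define $$s(\theta;t)=\frac{\sin\left(\frac{\varphi(t)-\theta_0}{2}\right)}{2\sin\left(\frac{\varphi(t)-\theta}{2}\right)\sin\left(\frac{\theta_0-\theta}{2}\right)},\qquad S(\theta;t)=\sum_{k=1}^{n}\frac{1}{1+\delta_{k,n-1}+\delta_{k,n}}\cot\left(\frac{\varphi_k(t)-\theta}{2}\right),$$ $$W(\theta;t)=s(\theta;t)\left(\frac{1}{\omega(\theta;t)}\frac{\partial\omega}{\partial t}(\theta;t)-\frac{1}{\omega(\varphi(t);t)}\left.\frac{\partial\omega}{\partial t}(\theta;t)\right|_{\theta=\varphi(t)}\right),$$ and $$W_j(t)=s(\omega_j(t);t)\,\frac{\mathrm{d}\gamma_j}{\mathrm{d}t}(t)-\gamma_j(t)\,s(\omega_j(t);t)\,S(\omega_j(t);t)\,\frac{\mathrm{d}\omega_j}{\mathrm{d}t}(t)-\gamma_j(t)\,s(\omega_j(t);t)\,\frac{1}{\omega(\varphi(t);t)}\left.\frac{\partial\omega}{\partial t}(\theta;t)\right|_{\theta=\varphi(t)}.$$ Then $\zeta(t)=e^{i\varphi(t)}$ moves strictly counterclockwise on $I_\epsilon(t_0)$, provided that $$f(\theta;t)=\frac{1}{\omega(\theta;t)}\frac{\partial\omega}{\partial t}(\theta;t)$$ is an increasing function of $\theta$ on $(\theta_0,\theta_0+2\pi)$ and $W_j(t)\ge 0$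 for all $t\in I_\epsilon(t_0)$ and all $j$, with at least one of the conditions being strict. Furthermore, if $W(\theta;t)=W_j(t)=0$ for all $t\in I_\epsilon(t_0)$ and for all $j$, then $\zeta(t)$ does not move as $t$ increases on $I_\epsilon(t_0)$.
   Context: Notation: $\mathbb{D}_r(c)$ is the open disk in $\mathbb{C}$ of radius $r>0$ centred at $c$; $\mathbb{S}^1$ is the unit circle; $C_r(c)=\mathbb{D}_r(c)\cap\mathbb{S}^1$; $I_r(c)=\mathbb{D}_r(c)\cap\mathbb{R}$ (for $I_\epsilon(t_0)$, $\epsilon$ is small enough that $I_\epsilon(t_0)\subset J$). $\mathrm{d}\mu(\theta)$ (one argument) is a measure on the circle not depending on $t$, $\omega(\theta;t)$ is a weight function (distinct from the mass locations $\omega_j(t)$), and $\mathrm{d}\mu(\theta;t)$ (two arguments) is the full measure, which has infinite support, i.e. is not a finite combination of point masses. The mass points $e^{i\omega_0(t)},\dots,e^{i\omega_N(t)}$ are distinct. $\delta(\theta-\omega)$ denotes the unit point mass at $e^{i\omega}$, and $\delta_{k,m}$ is the Kronecker delta. Arguments of points of the circle are taken in $[\theta_0,\theta_0+2\pi)$. ''Increasing'' without ''strictly'' means nondecreasing; ''at least one of the conditions being strict'' means that $f$ is strictly increasing in $\theta$ or $W_j(t)>0$ for at least one $j$. Orthogonal polynomials: $Q_m(z;t)=z^m+\cdots$ denotes the monic orthogonal polynomial of degree $m$ on the unit circle with respect to $\mathrm{d}\mu(\cdot;t)$, i.e. $\int Q_m(e^{i\theta};t)\overline{Q_l(e^{i\theta};t)}\,\mathrm{d}\mu(\theta;t)=0$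 for $l\ne m$ and $\int|Q_m(e^{i\theta};t)|^2\mathrm{d}\mu(\theta;t)\ne 0$. POPUC: the monic paraorthogonal polynomial of degree $n$ associated with $\mathrm{d}\mu(\cdot;t)$ and a paraorthogonality parameter $b(t)\in\mathbb{S}^1$ is $$P(z;t)=zQ_{n-1}(z;t)-\overline{b(t)}\,Q_{n-1}^*(z;t),\qquad Q_{n-1}^*(z;t)=z^{n-1}\overline{Q_{n-1}(1/\overline z;t)}.$$ All its zeros are simple and lie on $\mathbb{S}^1$. ''Moves strictly counterclockwise'' means that the continuous argument $\varphi(t)$ of $\zeta(t)$ is strictly increasing in $t$; ''does not move'' means $\zeta(t)$ is constant.
   Formalization: Part (1) additionally assumes that the parameter b(t) is differentiable on J (it fails for discontinuous b, e.g. n=1 with Lebesgue measure); part (2) assumes that no mass point e^{iω_j(t)} is a zero of P(·;t), so that every W_j(t) is defined. *)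

(* Defs.v *)
From HB Require Import structures.
From mathcomp Require Import all_boot all_order all_algebra.
From mathcomp Require Import all_classical all_reals all_analysis.
From mathcomp Require Import measurable_realfun.
From mathcomp Require Export complex.

Set Implicit Arguments.
Unset Strict Implicit.
Unset Printing Implicit Defensive.

Import Order.TTheory GRing.Theory Num.Theory.
Import numFieldNormedType.Exports.

Local Open Scope classical_set_scope.
Local Open Scope ring_scope.
Local Open Scope complex_scope.

Section Circle.
Variable R : realType.

Definition expi (theta : R) : R[i] := cos theta +i* sin theta.

(* Measures on the unit circle are represented as Borel measures in the
   variable theta, on the half-open arc of arguments [theta0, theta0 + 2 pi). *)
Definition args (theta0 : R) : set (measurableTypeR R) :=
  `[theta0, theta0 + 2 * pi[%classic.

Definition I_ (eps c : R) : set R := [set t | `|t - c| < eps].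

Definition C_ (delta : R) (c : R[i]) : set R[i] :=
  [set z | `|z - c| < delta%:C /\ `|z| = 1].

(* Differentiability, in the real variable, of a complex-valued function. *)
Definition cderivable (f : R -> R[i]) (t : R) : Prop :=
  derivable (fun u => complex.Re (f u)) t 1 /\
  derivable (fun u => complex.Im (f u)) t 1.

Definition cot (x : R) : R := cos x / sin x.

End Circle.

Section OrthogonalPolynomials.
Variable R : realType.
Implicit Types (D : set (measurableTypeR R)) (p q : {poly R[i]}).

Definition cintegral (nu : {measure set (measurableTypeR R) -> \bar R}) D
    (f : R -> R[i]) : R[i] :=
  (\int[nu]_(theta in D) complex.Re (f theta))
  +i* (\int[nu]_(theta in D) complex.Im (f theta)).

Definition inner (nu : {measure set (measurableTypeR R) -> \bar R}) D p q
    : R[i] :=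
  cintegral nu D (fun theta => p.[expi theta] * (q.[expi theta])^*).

Definition finite_point_masses
    (nu : {measure set (measurableTypeR R) -> \bar R}) D : Prop :=
  exists (s : seq R) (c : R -> R), forall A, measurable A -> A `<=` D ->
    nu A = (\sum_(x <- s) (c x)%:E * \d_x A)%E.

Definition monic_OPUC (nu : {measure set (measurableTypeR R) -> \bar R}) D
    (Q : nat -> {poly R[i]}) : Prop :=
  forall m, [/\ Q m \is monic, size (Q m) = m.+1,
    (forall l, l <> m -> inner nu D (Q m) (Q l) = 0) &
    inner nu D (Q m) (Q m) <> 0].

(* The polynomial z ^ m * conj (q (1 / conj z)), for q of degree at most m;
   see horner_reversed. *)
Definition reversed (m : nat) q : {poly R[i]} :=
  \poly_(k < m.+1) (q`_(m - k))^*.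

Lemma horner_reversed (m : nat) q (z : R[i]) : (size q <= m.+1)%N -> z != 0 ->
  (reversed m q).[z] = z ^+ m * (q.[(z^*)^-1])^*.
Proof.
move=> sq z0; rewrite /reversed horner_poly (horner_coef_wide _ sq).
rewrite (rmorph_sum conjc) mulr_sumr.
rewrite (reindex_inj rev_ord_inj) /=; apply: eq_bigr => i _.
have im : (i <= m)%N by rewrite -ltnS.
rewrite subSS subKn // rmorphM rmorphXn fmorphV /= conjcK mulrCA; congr (_ * _).
by rewrite exprVn -expfB_cond ?(negbTE z0) //= add0n.
Qed.

(* P(z) = z Q_(n-1)(z) - conj b * Q_(n-1)^*(z). *)
Definition POPUC (n : nat) (Q : nat -> {poly R[i]}) (b : R[i])
    : {poly R[i]} :=
  'X * Q n.-1 - (b^*)%:P * reversed n.-1 (Q n.-1).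

End OrthogonalPolynomials.

Section Zeros.
Variable R : realType.
Variable P : R -> {poly R[i]}.

Definition zero_function (t0 : R) (z0 : R[i]) (eps delta : R)
    (zeta : R -> R[i]) : Prop :=
  zeta t0 = z0 /\
  forall t, I_ eps t0 t ->
    [/\ C_ delta z0 (zeta t), cderivable zeta t & (P t).[zeta t] = 0].

Definition unique_zero_function (t0 : R) (z0 : R[i]) (eps delta : R)
    (zeta : R -> R[i]) : Prop :=
  zero_function t0 z0 eps delta zeta /\
  forall xi, zero_function t0 z0 eps delta xi ->
    forall t, I_ eps t0 t -> xi t = zeta t.

(* phi 1, ..., phi n (indices start at 1) are the arguments, taken in
   [theta0, theta0 + 2 pi), of the n zeros of P t. *)
Definition zero_arguments (D : set R) (theta0 : R) (n : nat)
    (phi : nat -> R -> R) : Prop :=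
  forall t, D t ->
    (forall k, (1 <= k <= n)%N -> args theta0 (phi k t)) /\
    P t = \prod_(1 <= k < n.+1) ('X - (expi (phi k t))%:P).

Definition moves_strictly_counterclockwise (D : set R) (zeta : R -> R[i])
    (phi : R -> R) : Prop :=
  [/\ {within D, continuous phi},
      (forall t, D t -> zeta t = expi (phi t)) &
      (forall t u, D t -> D u -> t < u -> phi t < phi u)].

Definition does_not_move (D : set R) (zeta : R -> R[i]) : Prop :=
  forall t u, D t -> D u -> zeta t = zeta u.

End Zeros.

Section Weights.
Variables (R : realType) (theta0 : R) (n N : nat).
Variables (w : R -> R -> \bar R) (gamma omega : 'I_N.+1 -> R -> R).
Variable phi : nat -> R -> R.
Implicit Types theta t : R.

(* The weight w theta t is finite only for almost every theta, hence the use of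
   fine. Since x / 0 = 0 here, s_ theta t is 0 (and not infinite) when theta is
   phi n t or theta0. *)
Definition dt_weight theta t : R := derive1 (fun u => fine (w theta u)) t.

Definition logdt_weight theta t : R :=
  (fine (w theta t))^-1 * dt_weight theta t.

Definition s_ theta t : R :=
  sin ((phi n t - theta0) / 2) /
  (2 * sin ((phi n t - theta) / 2) * sin ((theta0 - theta) / 2)).

Definition S_ theta t : R :=
  \sum_(1 <= k < n.+1)
    (1 + (k == n.-1)%:R + (k == n)%:R)^-1 * cot ((phi k t - theta) / 2).

Definition W theta t : R :=
  s_ theta t * (logdt_weight theta t - logdt_weight (phi n t) t).

Definition Wmass (j : 'I_N.+1) t : R :=
  s_ (omega j t) t * derive1 (gamma j) t
  - gamma j t * s_ (omega j t) t * S_ (omega j t) t * derive1 (omega j) t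
  - gamma j t * s_ (omega j t) t * logdt_weight (phi n t) t.

End Weights.

(* Main.v *)
Require Import Defs.
From mathcomp Require Import all_boot all_order all_algebra.
From mathcomp Require Import all_classical all_reals all_analysis.
From mathcomp Require Import measurable_realfun ring lra.
Import Order.TTheory GRing.Theory Num.Theory.
Import numFieldNormedType.Exports.
Local Open Scope classical_set_scope.
Local Open Scope ring_scope.
Set Implicit Arguments.
Unset Strict Implicit.
Unset Printing Implicit Defensive.

(** Everything rests on one property of a paraorthogonal polynomial P of degree n:
    it is orthogonal to z, ..., z^(n-1).

    Zeros. If P = (z - a)(z - 1/conj a) r, then <P, z r> is a nonzero multiple of
    the squared norm of (z - a) r, because conj z = 1/z on the circle. As this
    inner product is zero and the measure has infinite support, P has no such pair
    of zeros (paraorth_no_reflected_pair). Since the reversal of P is - b P, its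
    zeros come in reflected pairs; hence they lie on the circle and are simple.

    Coefficients. The moments of the measure are differentiable, by
    differentiation under the integral sign. Together with its value at one point
    of the closed disc, orthogonality determines P through an invertible linear
    system of moments, so that its coefficients are differentiable
    (cderivable_paraorth_coef). The point is 0 in the first part, where the value
    is - conj b, and the fixed zero in the second. A simple zero of a polynomial
    with differentiable coefficients moves differentiably (simple_zero_function).

    Velocity. Write P_t = (z - zeta_t)(z - e0) R_t, with e0 the fixed zero. The
    relation <P_u, z R_t>_u = 0 holds at time u, and <P_t, z R_u>_t = 0 at time t.
    After conjugation, the second one is again a relation between z R_t and R_u:
    (z - zeta_t)(z - e0) R_u is orthogonal to z R_t at time t. Subtracting, the
    increment of zeta is balanced by the increment of the measure alone, and no
    other zero has to be differentiated (velocity_equation). Up to a constant,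
    P conj(z R) is the real function |P|^2 s, and for zeta = e^(i phi) the limit
    u -> t reads

        phi'(t) A = d/du (integral of |P_t|^2 s d nu_u) at u = t,

    where A > 0 is the squared norm of (z - e0) R_t. The integral of |P|^2 s
    against nu_t is zero, so that any multiple of it may be subtracted from the
    right side; this gives

        phi'(t) A = integral of |P|^2 W omega d mu + sum_j |P(omega_j)|^2 W_j

    (velocity_formula). Since s changes sign at the moving zero, an increasing
    logarithmic derivative of the weight makes W nonnegative. If it is strictly
    increasing, the integral is positive, because otherwise the measure would have
    finite support. *)

(** * Complex numbers *)

Section ComplexCalculus.
Variable R : realType.
Local Open Scope complex_scope.
Implicit Types (f g : R -> R[i]) (t : R) (x y z : R[i]).

Lemma cReD x y : complex.Re (x + y) = complex.Re x + complex.Re y.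
Proof. by case: x y => [a b] [c d]. Qed.

Lemma cImD x y : complex.Im (x + y) = complex.Im x + complex.Im y.
Proof. by case: x y => [a b] [c d]. Qed.

Lemma cReN x : complex.Re (- x) = - complex.Re x.
Proof. by case: x => [a b]. Qed.

Lemma cImN x : complex.Im (- x) = - complex.Im x.
Proof. by case: x => [a b]. Qed.

Lemma cReM x y : complex.Re (x * y)
  = complex.Re x * complex.Re y - complex.Im x * complex.Im y.
Proof. by case: x y => [a b] [c d]. Qed.

Lemma cImM x y : complex.Im (x * y)
  = complex.Re x * complex.Im y + complex.Im x * complex.Re y.
Proof. by case: x y => [a b] [c d] /=; rewrite addrC. Qed.

Lemma Re_conjc x : complex.Re (conjc x) = complex.Re x.
Proof. by case: x. Qed.

Lemma Im_conjc x : complex.Im (conjc x) = - complex.Im x.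
Proof. by case: x. Qed.
Definition ReImE := (cReD, cImD, cReN, cImN, cReM, cImM, Re_conjc, Im_conjc).

Lemma complex_ext x y : complex.Re x = complex.Re y ->
  complex.Im x = complex.Im y -> x = y.
Proof. by case: x y => [a b] [c d] /= -> ->. Qed.

Lemma conjcB x y : conjc (x - y) = conjc x - conjc y.
Proof. exact: (rmorphB conjc). Qed.

Lemma conjcM x y : conjc (x * y) = conjc x * conjc y.
Proof. exact: (rmorphM conjc). Qed.

Lemma mulcJ x : x * conjc x = (complex.Re x ^+ 2 + complex.Im x ^+ 2)%:C.
Proof. by apply: complex_ext; rewrite !ReImE /=; ring. Qed.

Lemma norm1_mulcJ z : `|z| = 1 -> z * conjc z = 1.
Proof.
by move=> z1; rewrite mulcJ add_Re2_Im2 z1 expr1n.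
Qed.

Lemma norm1_conjc z : `|z| = 1 -> conjc z = z^-1.
Proof.
move=> z1; have z0 : z != 0 by rewrite -normr_eq0 z1 oner_eq0.
by apply: (mulfI z0); rewrite norm1_mulcJ // divff.
Qed.

(** * Derivatives of complex-valued functions of a real variable *)

Definition is_cderive f t (d : R[i]) : Prop :=
  is_derive t (1 : R) (fun u => complex.Re (f u)) (complex.Re d) /\
  is_derive t (1 : R) (fun u => complex.Im (f u)) (complex.Im d).

Lemma is_derive_val (V W : normedModType R) (f : V -> W) (a v : V) df df' :
  df = df' -> is_derive a v f df -> is_derive a v f df'.
Proof. by move->. Qed.

Lemma cderivableP f t : cderivable f t <-> exists d, is_cderive f t d.
Proof.
split=> [[d1 d2]|[d [[d1 _] [d2 _]]]]; last exact: (conj d1 d2).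
exists ('D_1 (fun u => complex.Re (f u)) t +i* 'D_1 (fun u => complex.Im (f u)) t).
by split; [exact: (DeriveDef d1 erefl)|exact: (DeriveDef d2 erefl)].
Qed.

Lemma is_cderive_cst (c : R[i]) t : is_cderive (fun=> c) t 0.
Proof. by split; exact: is_derive_cst. Qed.

Lemma is_cderiveD f g t df dg : is_cderive f t df -> is_cderive g t dg ->
  is_cderive (fun u => f u + g u) t (df + dg).
Proof.
move=> [f1 f2] [g1 g2]; split; rewrite ReImE.
  under eq_fun do rewrite ReImE; exact: is_deriveD.
under eq_fun do rewrite ReImE; exact: is_deriveD.
Qed.

Lemma is_cderiveM f g t df dg : is_cderive f t df -> is_cderive g t dg ->
  is_cderive (fun u => f u * g u) t (df * g t + f t * dg).
Proof.
move=> [f1 f2] [g1 g2]; split; rewrite !ReImE.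
  under eq_fun do rewrite ReImE.
  apply: is_derive_val (is_deriveB (is_deriveM f1 g1) (is_deriveM f2 g2)).
  by rewrite /GRing.scale /=; ring.
under eq_fun do rewrite ReImE.
apply: is_derive_val (is_deriveD (is_deriveM f1 g2) (is_deriveM f2 g1)).
by rewrite /GRing.scale /=; ring.
Qed.

Lemma is_cderive_conjc f t df : is_cderive f t df ->
  is_cderive (fun u => conjc (f u)) t (conjc df).
Proof.
move=> [f1 f2]; split; rewrite ReImE; under eq_fun do rewrite ReImE.
  exact: f1.
exact: is_deriveN.
Qed.

Lemma is_cderiveN f t df : is_cderive f t df ->
  is_cderive (fun u => - f u) t (- df).
Proof.
move=> [f1 f2]; split; rewrite ReImE; under eq_fun do rewrite ReImE;
  exact: is_deriveN.
Qed.

Lemma is_cderive_sum (I : Type) (r : seq I) (p : pred I) (f : I -> R -> R[i]) t df :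
  (forall i, is_cderive (f i) t (df i)) ->
  is_cderive (fun u => \sum_(i <- r | p i) f i u) t (\sum_(i <- r | p i) df i).
Proof.
move=> h; elim: r => [|i r IH].
  by under eq_fun do rewrite big_nil; rewrite big_nil; exact: is_cderive_cst.
under eq_fun do rewrite big_cons; rewrite big_cons.
case: (p i); last exact: IH.
exact: (is_cderiveD (h i) IH).
Qed.

Lemma is_cderive_val f t d d' : d = d' -> is_cderive f t d -> is_cderive f t d'.
Proof. by move->. Qed.

Lemma is_cderive_unique f t d d' :
  is_cderive f t d -> is_cderive f t d' -> d = d'.
Proof.
move=> [[_ a1] [_ b1]] [[_ a2] [_ b2]].
by apply: complex_ext; [rewrite -a1 a2|rewrite -b1 b2].
Qed.

Lemma is_cderive_near f g t d : (\near t, f t = g t) ->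
  is_cderive f t d -> is_cderive g t d.
Proof.
move=> fg [f1 f2]; split.
  by apply: near_eq_is_derive f1; apply: filterS fg => u ->.
by apply: near_eq_is_derive f2; apply: filterS fg => u ->.
Qed.

Lemma cderivableD f g t : cderivable f t -> cderivable g t ->
  cderivable (fun u => f u + g u) t.
Proof.
move=> /cderivableP[d fd] /cderivableP[e ge]; apply/cderivableP.
by exists (d + e); exact: is_cderiveD.
Qed.

Lemma cderivableM f g t : cderivable f t -> cderivable g t ->
  cderivable (fun u => f u * g u) t.
Proof.
move=> /cderivableP[d fd] /cderivableP[e ge]; apply/cderivableP.
by exists (d * g t + f t * e); exact: is_cderiveM.
Qed.

Lemma cderivable_cst c t : cderivable (fun=> c) t.
Proof. by apply/cderivableP; exists 0; exact: is_cderive_cst. Qed.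

Lemma cderivable_sum (I : Type) (r : seq I) (p : pred I) (f : I -> R -> R[i]) t :
  (forall i, cderivable (f i) t) ->
  cderivable (fun u => \sum_(i <- r | p i) f i u) t.
Proof.
move=> h; elim: r => [|i r IH].
  by under eq_fun do rewrite big_nil; exact: cderivable_cst.
under eq_fun do rewrite big_cons.
case: (p i); last exact: IH.
exact: (cderivableD (h i) IH).
Qed.

Lemma cderivable_prod (I : Type) (r : seq I) (p : pred I) (f : I -> R -> R[i]) t :
  (forall i, cderivable (f i) t) ->
  cderivable (fun u => \prod_(i <- r | p i) f i u) t.
Proof.
move=> h; elim: r => [|i r IH].
  by under eq_fun do rewrite big_nil; exact: cderivable_cst.
under eq_fun do rewrite big_cons.
case: (p i); last exact: IH.
exact: (cderivableM (h i) IH).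
Qed.

Lemma cderivable_conjc f t : cderivable f t -> cderivable (fun u => conjc (f u)) t.
Proof.
move=> /cderivableP[d fd]; apply/cderivableP.
by exists (conjc d); exact: is_cderive_conjc.
Qed.

Lemma cderivableN f t : cderivable f t -> cderivable (fun u => - f u) t.
Proof.
move=> /cderivableP[d fd]; apply/cderivableP.
by exists (- d); exact: is_cderiveN.
Qed.

Lemma cderivable_near f g t : (\near t, f t = g t) ->
  cderivable f t -> cderivable g t.
Proof.
move=> fg /cderivableP[d fd]; apply/cderivableP.
by exists d; exact: is_cderive_near fd.
Qed.

Lemma Re_mulcJ_eq0 x : (complex.Re (x * conjc x) == 0) = (x == 0).
Proof.
apply/eqP/eqP => [|->]; last by rewrite mul0r.
rewrite mulcJ /= => /eqP; rewrite paddr_eq0 ?sqr_ge0 // !sqrf_eq0.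
by case: x => a b /= /andP[/eqP-> /eqP->].
Qed.

Lemma invcE x : x^-1 = conjc x * ((complex.Re (x * conjc x))^-1)%:C.
Proof.
have [->|x0] := eqVneq x 0; first by rewrite invr0 rmorph0 mul0r.
apply: (mulfI x0); rewrite divff // mulrA {1}mulcJ mulcJ -rmorphM divff //.
by rewrite -[X in X != 0]/(complex.Re _%:C) -mulcJ Re_mulcJ_eq0.
Qed.

Lemma cderivableV f t : f t != 0 -> cderivable f t ->
  cderivable (fun u => (f u)^-1) t.
Proof.
move=> f0 fd; under eq_fun do rewrite invcE.
apply: cderivableM; first exact: cderivable_conjc.
have [d _] := cderivableM fd (cderivable_conjc fd).
split => /=; last exact: derivable_cst.
apply: (@derivableV _ _ (fun u => complex.Re (f u * conjc (f u))) t 1 _ d).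
by rewrite Re_mulcJ_eq0.
Qed.

Lemma cderivable_det n (M : R -> 'M[R[i]]_n) t :
  (forall i j, cderivable (fun u => M u i j) t) ->
  cderivable (fun u => \det (M u)) t.
Proof.
move=> h; apply: cderivable_sum => s; apply: cderivableM.
  exact: cderivable_cst.
exact: cderivable_prod.
Qed.

(** The solution of a linear system whose coefficients are differentiable is
    differentiable: Cramer's rule writes it as a quotient of determinants. *)
Lemma cderivable_linear_system n (M : R -> 'M[R[i]]_n) (x v : R -> 'cV[R[i]]_n) t :
  (forall i j, cderivable (fun u => M u i j) t) ->
  (forall i, cderivable (fun u => v u i 0) t) ->
  (\near t, M t \in unitmx /\ M t *m x t = v t) ->
  forall i, cderivable (fun u => x u i 0) t.
Proof.
move=> hM hv hx i.
apply: (@cderivable_near (fun u => \sum_j (\det (M u))^-1 * \adj (M u) i j * v u j 0)).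
  apply: filterS hx => u [Mu xu].
  by rewrite -(mulKmx Mu (x u)) xu /invmx Mu !mxE; apply: eq_bigr => j _; rewrite !mxE.
have [Mt _] := nbhs_singleton hx.
apply: cderivable_sum => j; apply: cderivableM => //; apply: cderivableM.
  apply: cderivableV; last exact: cderivable_det.
  by rewrite unitmxE unitfE in Mt.
under eq_fun do rewrite !mxE.
apply: cderivableM; first exact: cderivable_cst.
by apply: cderivable_det => k l; under eq_fun do rewrite !mxE.
Qed.

End ComplexCalculus.

(** * Bounded differentiable functions and their integrals *)

Section BoundedDifferentiable.
Variable R : realType.
Local Open Scope complex_scope.
Implicit Types (g : R -> R) (f : R -> R[i]).

(** Trigonometric polynomials are meant; boundedness and differentiability are
    what integration and the moving masses use of them. *)
Definition bdiff g : Prop :=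
  (forall x, derivable g x 1) /\ exists M, forall x, `|g x| <= M.

Definition cbdiff f : Prop :=
  bdiff (fun x => complex.Re (f x)) /\ bdiff (fun x => complex.Im (f x)).

Lemma bdiff_cst (c : R) : bdiff (fun=> c).
Proof. by split=> [x|]; [exact: derivable_cst|exists `|c|]. Qed.

Lemma bdiffD g1 g2 : bdiff g1 -> bdiff g2 -> bdiff (fun x => g1 x + g2 x).
Proof.
move=> [d1 [M1 b1]] [d2 [M2 b2]]; split=> [x|]; first exact: (derivableD (d1 x) (d2 x)).
by exists (M1 + M2) => x; apply: (le_trans (ler_normD _ _)); apply: lerD.
Qed.

Lemma bdiffN g : bdiff g -> bdiff (fun x => - g x).
Proof.
move=> [d1 [M1 b1]]; split=> [x|]; first exact: (derivableN (d1 x)).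
by exists M1 => x; rewrite normrN.
Qed.

Lemma bdiffM g1 g2 : bdiff g1 -> bdiff g2 -> bdiff (fun x => g1 x * g2 x).
Proof.
move=> [d1 [M1 b1]] [d2 [M2 b2]]; split=> [x|]; first exact: (derivableM (d1 x) (d2 x)).
by exists (M1 * M2) => x; rewrite normrM; apply: ler_pM.
Qed.

Lemma bdiff_continuous g : bdiff g -> continuous g.
Proof.
move=> [d _] x; apply: differentiable_continuous.
by apply/derivable1_diffP; exact: d.
Qed.

Lemma bdiff_measurable g (D : set (measurableTypeR R)) : bdiff g -> measurable_fun D g.
Proof.
move=> gb; apply: measurable_funTS.
by apply: continuous_measurable_fun; exact: bdiff_continuous.
Qed.

Lemma bdiff_bounded g (D : set R) : bdiff g -> [bounded g x | x in D].
Proof.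
move=> [_ [M b]]; exists M; split; first exact: num_real.
by move=> y My x _ /=; apply: (le_trans (b x)); exact: ltW.
Qed.

Lemma bdiff_sin : bdiff (@sin R).
Proof.
split=> [x|]; first by have [] := is_derive_sin x.
by exists 1 => x; exact: sin_max.
Qed.

Lemma bdiff_cos : bdiff (@cos R).
Proof.
split=> [x|]; first by have [] := is_derive_cos x.
by exists 1 => x; exact: cos_max.
Qed.

Lemma cbdiff_cst c : cbdiff (fun=> c).
Proof. by split; exact: bdiff_cst. Qed.

Lemma cbdiffD f1 f2 : cbdiff f1 -> cbdiff f2 -> cbdiff (fun x => f1 x + f2 x).
Proof.
by move=> [a1 b1] [a2 b2]; split; under eq_fun do rewrite ReImE; exact: bdiffD.
Qed.

Lemma cbdiffM f1 f2 : cbdiff f1 -> cbdiff f2 -> cbdiff (fun x => f1 x * f2 x).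
Proof.
move=> [a1 b1] [a2 b2]; split; under eq_fun do rewrite ReImE.
  by apply: bdiffD; [exact: bdiffM|apply: bdiffN; exact: bdiffM].
by apply: bdiffD; exact: bdiffM.
Qed.

Lemma cbdiff_conjc f : cbdiff f -> cbdiff (fun x => conjc (f x)).
Proof.
move=> [a b]; split; under eq_fun do rewrite ReImE; first exact: a.
exact: bdiffN.
Qed.

Lemma cbdiff_sum (I : Type) (r : seq I) (f : I -> R -> R[i]) :
  (forall i, cbdiff (f i)) -> cbdiff (fun x => \sum_(i <- r) f i x).
Proof.
move=> h; elim: r => [|i r IH].
  by under eq_fun do rewrite big_nil; exact: cbdiff_cst.
under eq_fun do rewrite big_cons; exact: (cbdiffD (h i) IH).
Qed.

Lemma cbdiff_expi : cbdiff (@expi R).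
Proof. by split; [exact: bdiff_cos|exact: bdiff_sin]. Qed.

Lemma cbdiff_horner (p : {poly R[i]}) : cbdiff (fun x => p.[expi x]).
Proof.
under eq_fun do rewrite horner_coef; apply: cbdiff_sum => i.
apply: (cbdiffM (cbdiff_cst _)); elim: (val i) => [|n IH]; first exact: cbdiff_cst.
by under eq_fun do rewrite exprS; exact: (cbdiffM cbdiff_expi IH).
Qed.

Lemma norm_expi (x : R) : `|expi x| = 1.
Proof. by rewrite normc_def /= cos2Dsin2 sqrtr1. Qed.

Lemma expi_neq0 (x : R) : expi x != 0.
Proof. by rewrite -normr_eq0 norm_expi oner_eq0. Qed.

Lemma expi_conj (x : R) : conjc (expi x) = (expi x)^-1.
Proof. exact/norm1_conjc/norm_expi. Qed.

Lemma expiD (x y : R) : expi (x + y) = expi x * expi y.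
Proof. by apply: complex_ext; rewrite !ReImE /= ?cosD ?sinD; ring. Qed.

Lemma expiN (x : R) : expi (- x) = (expi x)^-1.
Proof. by rewrite -expi_conj; apply: complex_ext; rewrite !ReImE /= ?cosN ?sinN. Qed.

Variables (nu : {finite_measure set (measurableTypeR R) -> \bar R})
          (D : set (measurableTypeR R)).
Hypothesis mD : measurable D.

Lemma bdiff_integrable g : bdiff g -> nu.-integrable D (EFin \o g).
Proof.
move=> gb; apply: measurable_bounded_integrable => //.
- by rewrite ltey_eq fin_num_measure.
- exact: bdiff_measurable.
- exact: bdiff_bounded.
Qed.

Lemma cintegralD f1 f2 : cbdiff f1 -> cbdiff f2 ->
  cintegral nu D (fun x => f1 x + f2 x) = cintegral nu D f1 + cintegral nu D f2.
Proof.
move=> [a1 b1] [a2 b2]; apply: complex_ext; rewrite ReImE /=;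
  under eq_Rintegral do rewrite ReImE; rewrite RintegralD //; exact: bdiff_integrable.
Qed.

Lemma cintegralZ c f : cbdiff f ->
  cintegral nu D (fun x => c * f x) = c * cintegral nu D f.
Proof.
move=> [a b]; apply: complex_ext; rewrite ReImE /=;
  under eq_Rintegral do rewrite ReImE; rewrite -!RintegralZl //;
  try exact: bdiff_integrable.
  by rewrite RintegralB //; apply: bdiff_integrable;
    apply: bdiffM => //; exact: bdiff_cst.
by rewrite RintegralD //; apply: bdiff_integrable;
    apply: bdiffM => //; exact: bdiff_cst.
Qed.

Lemma cintegral_conjc f : cbdiff f ->
  cintegral nu D (fun x => conjc (f x)) = conjc (cintegral nu D f).
Proof.
move=> [a b]; apply: complex_ext; rewrite !ReImE /=;
  under eq_Rintegral do rewrite ReImE.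
  by [].
rewrite -[RHS]mulN1r -RintegralZl //; last exact: bdiff_integrable.
by under [RHS]eq_Rintegral do rewrite mulN1r.
Qed.

Lemma eq_cintegral f1 f2 : {in D, f1 =1 f2} -> cintegral nu D f1 = cintegral nu D f2.
Proof.
move=> e; congr (_ +i* _); apply: eq_Rintegral => x xD; by rewrite e.
Qed.

End BoundedDifferentiable.

(** * Positivity of the inner product *)

Section Positivity.
Variables (R : realType) (theta0 : R).
Variable nu : {finite_measure set (measurableTypeR R) -> \bar R}.
Local Open Scope complex_scope.
Local Notation D := (args theta0).
Implicit Types (f : R -> R[i]) (p q : {poly R[i]}).

Lemma measurable_args : measurable (args theta0).
Proof. exact: measurable_itv. Qed.
Hint Resolve measurable_args : core.

Lemma expi_inj : {in D &, injective (@expi R)}.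
Proof.
have wlg (x y : R) : D x -> D y -> y <= x -> expi x = expi y -> x = y.
  rewrite /args /= !in_itv /= => /andP[x0 x1] /andP[y0 y1] yx e.
  have h : sin ((x - y) / 2) = 0.
    have : cos (x - y) = 1.
      have : expi (x - y) = 1 by rewrite expiD expiN e divff ?expi_neq0.
      by move=> /(congr1 (@complex.Re R)).
    have -> : cos (x - y) = cos (((x - y) / 2) *+ 2).
      by congr cos; rewrite -mulr_natr -mulrA mulVf ?mulr1 // pnatr_eq0.
    rewrite cos_mulr2n cos2sin2 => c1.
    by apply/eqP; rewrite -sqrf_eq0; apply/eqP; lra.
  apply/eqP; rewrite eq_le yx andbT leNgt; apply/negP => xy.
  by have := @sin_gt0_pi R ((x - y) / 2); rewrite h ltxx => /(_ ltac:(lra)).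
move=> x y; rewrite !inE => Dx Dy e.
have [yx|xy] := leP y x; first exact: wlg.
exact/esym/(wlg _ _ Dy Dx (ltW xy) (esym e)).
Qed.

Lemma set_seq_cons (x : R) (s : seq R) : [set` x :: s] = [set x] `|` [set` s].
Proof.
apply/seteqP; split => y /=; rewrite in_cons.
  by move=> /orP[/eqP->|ys]; [left|right].
by move=> [->|ys]; rewrite ?eqxx // ys orbT.
Qed.

Lemma measurable_seq (s : seq R) : measurable ([set` s] : set (measurableTypeR R)).
Proof.
elim: s => [|y r IHr]; first by rewrite set_nil.
by rewrite set_seq_cons; apply: measurableU.
Qed.

Lemma measure_seq_setI (s : seq R) (A : set (measurableTypeR R)) :
  measurable A -> uniq s ->
  nu (A `&` [set` s]) = (\sum_(x <- s) (fine (nu [set x]))%:E * \d_x A)%E.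
Proof.
move=> mA; elim: s => [|x s IH] /=.
  by rewrite big_nil set_nil setI0 measure0.
move=> /andP[xs us]; rewrite big_cons -IH //.
rewrite set_seq_cons setIUr measureU //; first last.
- rewrite setIACA setIid; apply/seteqP; split => // y /= [_ [->]].
  by rewrite (negbTE xs).
- exact: measurableI mA (measurable_seq s).
- by apply: measurableI.
congr (_ + _)%E; rewrite diracE fineK ?fin_num_measure //.
case: (boolP (x \in A)) => xA; rewrite ?mule1 ?mule0.
  by congr (nu _); apply/setIidPr => y /= ->; rewrite inE in xA.
have -> : A `&` [set x] = set0; last by rewrite measure0.
apply/seteqP; split => // y [Ay /= yx].
by move: xA; rewrite -yx => /negP; apply; rewrite inE.
Qed.

Lemma finite_point_massesP (s : seq R) :
  nu (D `\` [set` s]) = 0%E -> finite_point_masses nu D.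
Proof.
move=> nu0; exists (undup s), (fun x => fine (nu [set x])) => A mA AD.
rewrite -measure_seq_setI ?undup_uniq //.
have -> : [set` undup s] = [set` s] by apply/seteqP; split => x /=; rewrite mem_undup.
rewrite (measureDI nu mA (measurable_seq s)) -[RHS]add0e; congr (_ + _)%E.
apply/eqP; rewrite eq_le measure_ge0 andbT -nu0; apply: le_measure; rewrite ?inE.
- exact: (measurableD mA (measurable_seq s)).
- exact: (measurableD measurable_args (measurable_seq s)).
- by move=> x [Ax xs]; split => //; exact: AD.
Qed.

Lemma unit_roots_seq p : p != 0 ->
  exists s : seq R, forall x, D x -> p.[expi x] = 0 -> x \in s.
Proof.
move=> p0; have [rs prs] := closed_field_poly_normal p.
pose g (z : R[i]) : R := xget 0 [set x | D x /\ expi x = z].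
exists (map g rs) => x Dx px; apply/mapP; exists (expi x).
  have : root p (expi x) by rewrite rootE px.
  by rewrite prs rootZ ?lead_coef_eq0 // root_prod_XsubC.
rewrite /g; case: xgetP => [y _ [Dy yx]|/(_ x)]; last by case.
by apply: expi_inj; rewrite ?inE.
Qed.

End Positivity.

Section InnerProduct.
Variables (R : realType) (theta0 : R).
Variable nu : {finite_measure set (measurableTypeR R) -> \bar R}.
Local Open Scope complex_scope.
Local Notation D := (args theta0).
Implicit Types (p q r : {poly R[i]}) (c : R[i]).
Local Notation ip := (inner nu D).
Local Notation mD := (@measurable_args R theta0).

Lemma cbdiff_inner p q : cbdiff (fun x => p.[expi x] * conjc (q.[expi x])).
Proof. by apply: cbdiffM; [|apply: cbdiff_conjc]; exact: cbdiff_horner. Qed.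

Lemma innerE p q : ip p q =
  cintegral nu D (fun x => p.[expi x] * conjc (q.[expi x])).
Proof. by []. Qed.

Lemma innerDl p q r : ip (p + q) r = ip p r + ip q r.
Proof.
rewrite !innerE -(cintegralD nu mD) //; try exact: cbdiff_inner.
by apply: eq_cintegral => x _; rewrite hornerD mulrDl.
Qed.

Lemma innerZl c p r : ip (c *: p) r = c * ip p r.
Proof.
rewrite !innerE -(cintegralZ nu mD) //; try exact: cbdiff_inner.
by apply: eq_cintegral => x _; rewrite hornerZ mulrA.
Qed.

Lemma inner_conj p q : ip q p = conjc (ip p q).
Proof.
rewrite !innerE -(cintegral_conjc nu mD) //; try exact: cbdiff_inner.
by apply: eq_cintegral => x _; rewrite rmorphM /= conjcK mulrC.
Qed.

Lemma inner0l r : ip 0 r = 0.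
Proof. by rewrite -(scale0r 0) innerZl mul0r. Qed.

Lemma innerDr p q r : ip r (p + q) = ip r p + ip r q.
Proof. by rewrite inner_conj innerDl rmorphD /=; congr (_ + _); exact/esym/inner_conj. Qed.

Lemma innerZr c p r : ip r (c *: p) = conjc c * ip r p.
Proof. by rewrite inner_conj innerZl rmorphM /=; congr (_ * _); exact/esym/inner_conj. Qed.

Lemma inner_suml (I : Type) (s : seq I) (P : pred I) (F : I -> {poly R[i]}) r :
  ip (\sum_(i <- s | P i) F i) r = \sum_(i <- s | P i) ip (F i) r.
Proof.
apply: (big_morph (fun p => (ip p r))) => [p q|]; [exact: innerDl|exact: inner0l].
Qed.

Lemma inner_sumr (I : Type) (s : seq I) (P : pred I) (F : I -> {poly R[i]}) r :
  ip r (\sum_(i <- s | P i) F i) = \sum_(i <- s | P i) ip r (F i).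
Proof.
rewrite inner_conj inner_suml rmorph_sum /=; apply: eq_bigr => i _.
exact/esym/inner_conj.
Qed.

(** Identities that hold only where conj z = 1/z enter through this lemma. *)
Lemma eq_inner_circle p q p' q' c :
  (forall z : R[i], `|z| = 1 -> p.[z] * conjc (q.[z]) = c * (p'.[z] * conjc (q'.[z]))) ->
  ip p q = c * ip p' q'.
Proof.
move=> h; rewrite !innerE -(cintegralZ nu mD); last exact: cbdiff_inner.
by apply: eq_cintegral => x _; rewrite h // norm_expi.
Qed.

Lemma inner_self p : ip p p =
  (\int[nu]_(x in D) complex.Re (p.[expi x] * conjc (p.[expi x])))%:C.
Proof.
rewrite !innerE /cintegral; congr (_ +i* _).
rewrite (_ : (fun x => _) = (fun=> 0)) ?Rintegral_cst ?mul0r //; first exact: mD.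
by apply/funext => x; rewrite mulcJ.
Qed.

Lemma Re_mulcJ_ge0 (x : R[i]) : 0 <= complex.Re (x * conjc x).
Proof. by rewrite mulcJ /= addr_ge0 ?sqr_ge0. Qed.

Lemma inner_self_ge0 p : 0 <= complex.Re (ip p p).
Proof. by rewrite inner_self /=; apply: Rintegral_ge0 => x _; exact: Re_mulcJ_ge0. Qed.

Lemma inner_self_Im p : complex.Im (ip p p) = 0.
Proof. by rewrite inner_self. Qed.

Hypothesis nu_inf : ~ finite_point_masses nu D.

(** A nonzero polynomial has finitely many zeros on the circle, so it cannot
    vanish almost everywhere for a measure of infinite support. *)
Lemma inner_self_gt0 p : p != 0 -> 0 < complex.Re (ip p p).
Proof.
move=> p0; rewrite lt_neqAle inner_self_ge0 andbT; apply/eqP => e.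
apply: nu_inf; have [s Ds] := unit_roots_seq theta0 p0.
apply: (@finite_point_massesP _ _ _ s).
pose g x := complex.Re (p.[expi x] * conjc (p.[expi x])).
have gb : bdiff g by have [] := cbdiff_inner p p.
have ig := bdiff_integrable nu mD gb.
have : (\int[nu]_(x in D) `|(g x)%:E| = 0)%E.
  transitivity (\int[nu]_(x in D) (EFin \o g) x)%E.
    by apply: eq_integral => x _; rewrite gee0_abs // lee_fin Re_mulcJ_ge0.
  rewrite -(fineK (integrable_fin_num mD ig)).
  by congr (_%:E); rewrite e inner_self.
move/(ae_eq_integral_abs nu mD (measurable_int nu ig)) => -[N [mN N0 DN]].
apply/eqP; rewrite eq_le measure_ge0 andbT -N0; apply: le_measure; rewrite ?inE //.
  exact: (measurableD mD (measurable_seq s)).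
move=> x [Dx xs]; apply: DN => /= /(_ Dx) [] /eqP.
rewrite /g Re_mulcJ_eq0 => /eqP px.
by apply: xs; exact: Ds.
Qed.

Lemma inner_self_eq0 p : ip p p = 0 -> p = 0.
Proof.
move=> pp; apply/eqP; apply: contraT => /inner_self_gt0.
by rewrite pp ltxx.
Qed.

End InnerProduct.

(** * Orthogonality and zeros of paraorthogonal polynomials *)

Section Paraorthogonal.
Variables (R : realType) (theta0 : R).
Variable nu : {finite_measure set (measurableTypeR R) -> \bar R}.
Local Open Scope complex_scope.
Local Notation D := (args theta0).
Implicit Types (p q r : {poly R[i]}) (c z : R[i]) (n : nat).
Local Notation ip := (inner nu D).

Lemma size_sub_lead p q : p \is monic -> size p = size q -> q != 0 ->
  (size (q - lead_coef q *: p)%R < size q)%N.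
Proof.
move=> /monicP pm sp q0; have sq : (0 < size q)%N by rewrite size_poly_gt0.
rewrite -[X in (_ < X)%N](prednK sq) ltnS; apply/leq_sizeP => j.
rewrite leq_eqVlt coefB coefZ => /predU1P[<-|].
  have -> : p`_(size q).-1 = 1 by rewrite -sp.
  by rewrite mulr1 subrr.
by rewrite prednK // => h; rewrite !nth_default ?mulr0 ?subr0 // sp.
Qed.

Lemma opuc_orth (Q : nat -> {poly R[i]}) m q : monic_OPUC nu D Q ->
  (size q <= m)%N -> ip (Q m) q = 0.
Proof.
move=> hQ; have [k] := ubnP (size q); elim: k q => // k IH q.
rewrite ltnS => qk qm; have [->|q0] := eqVneq q 0.
  by rewrite inner_conj inner0l rmorph0.
have sq : (0 < size q)%N by rewrite size_poly_gt0.
have [Qmon Qs _ _] := hQ (size q).-1; rewrite prednK // in Qs.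
have lt := size_sub_lead Qmon Qs q0.
rewrite -(subrK (lead_coef q *: Q (size q).-1) q) innerDr innerZr.
have ml : (size q).-1 <> m.
  by move=> h; move: qm; rewrite -h -[X in (X <= _)%N](prednK sq) ltnn.
have [_ _ /(_ _ ml) -> _] := hQ m.
by rewrite mulr0 addr0 IH //; [exact: leq_trans lt qk|exact: leq_trans (ltnW lt) qm].
Qed.

(** What is left of orthogonality for a paraorthogonal polynomial of degree n:
    the constant 1 is excluded. *)
Definition paraorth n p := forall k, (0 < k < n)%N -> ip p 'X^k = 0.

Lemma paraorth_mulX n p q : paraorth n p -> (size q < n)%N -> ip p ('X * q) = 0.
Proof.
move=> hp sq; rewrite -[q]coefK poly_def mulr_sumr inner_sumr big1 // => i _.
rewrite -scalerAr -exprS innerZr hp ?mulr0 //=.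
by apply: leq_ltn_trans sq.
Qed.

Lemma norm1_neq0 z : `|z| = 1 -> z != 0.
Proof. by move=> z1; rewrite -normr_eq0 z1 oner_eq0. Qed.

(** On the circle, (z - a)(z - 1/conj a) conj z is a multiple of |z - a|^2. *)
Lemma inner_reflected_pair (a : R[i]) r : a != 0 ->
  ip (('X - a%:P) * ('X - (conjc a)^-1%:P) * r) ('X * r) =
  - (conjc a)^-1 * ip (('X - a%:P) * r) (('X - a%:P) * r).
Proof.
move=> a0; apply: eq_inner_circle => z z1; rewrite !hornerM !hornerXsubC hornerX.
have z0 := norm1_neq0 z1; have ca0 : (conjc a) != 0 by rewrite conjc_eq0.
rewrite !(rmorphM conjc) /= !(rmorphB conjc) /= (norm1_conjc z1).
move: (conjc r.[z]) (r.[z]) (conjc a) ca0 => u v b b0; field.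
by rewrite z0 b0.
Qed.

(** Otherwise <p, z r> would be a nonzero multiple of the squared norm of
    (z - a) r. For |a| = 1 the pair is a double zero. *)
Lemma paraorth_no_reflected_pair n p r (a : R[i]) :
  ~ finite_point_masses nu D -> paraorth n p -> size p = n.+1 -> a != 0 ->
  p <> ('X - a%:P) * ('X - (conjc a)^-1%:P) * r.
Proof.
move=> nu_inf hp sp a0 e.
have p0 : p != 0 by rewrite -size_poly_gt0 sp.
have r0 : r != 0 by apply: contraNneq p0 => r0; rewrite e r0 mulr0.
have Xr0 : ('X - a%:P) * r != 0 by rewrite mulf_neq0 ?polyXsubC_eq0.
have sr : size r = n.-1.
  move: sp; rewrite e !size_mul ?mulf_neq0 ?polyXsubC_eq0 // !size_XsubC /=.
  by case=> <-.
have n0 : (0 < n)%N.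
  by case: n sr {sp hp} => // /eqP; rewrite size_poly_eq0 (negbTE r0).
have := inner_reflected_pair r a0; rewrite -e (paraorth_mulX hp); last first.
  by rewrite sr prednK.
move=> /esym/eqP; rewrite mulf_eq0 oppr_eq0 invr_eq0 conjc_eq0 (negbTE a0) /=.
by move=> /eqP/(inner_self_eq0 nu_inf)/eqP; rewrite (negbTE Xr0).
Qed.

(** A polynomial orthogonal to z, ..., z^(n-1) of degree less than n vanishes
    as soon as it vanishes at one point x of the closed unit disc: if
    p = (z - x) u, then |p|^2 + (1 - |x|^2) |u|^2 is twice the real part
    of p conj(z u), whose integral is zero. *)
Lemma paraorth_eq0 n p (x : R[i]) : ~ finite_point_masses nu D ->
  paraorth n p -> (size p <= n)%N -> `|x| <= 1 -> p.[x] = 0 -> p = 0.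
Proof.
move=> nu_inf hp sp x1 px; apply: (inner_self_eq0 nu_inf).
have [|p0] := eqVneq p 0; first by move->; rewrite inner0l.
have /factor_theorem[u pu] : root p x by rewrite rootE px.
have u0 : u != 0 by apply: contraNneq p0 => u0; rewrite pu u0 mul0r.
have su : (size u < n)%N.
  by move: sp; rewrite pu size_mul ?polyXsubC_eq0 // size_XsubC addn2.
have h := paraorth_mulX hp su.
have pp : p = 'X * u - x *: u by rewrite pu mulrC mulrBl mul_polyC.
have XX : ip ('X * u) ('X * u) = ip u u.
  rewrite -[RHS]mul1r; apply: eq_inner_circle => z z1; rewrite !hornerM hornerX (rmorphM conjc) /=.
  by rewrite mulrACA norm1_mulcJ.
have e1 : ip u u = x * ip u ('X * u).
  by move: h; rewrite {1}pp -scaleNr innerDl innerZl XX mulNr => /subr0_eq.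
have e2 : ip u u = conjc x * ip ('X * u) u.
  rewrite [LHS]inner_conj e1 (rmorphM conjc) /=; congr (_ * _).
  exact/esym/inner_conj.
have e3 : ip p p = - (1 - x * conjc x) * ip u u.
  rewrite {2}pp -scaleNr innerDr innerZr h add0r {1}pp -scaleNr innerDl innerZl.
  rewrite rmorphN /= mulrDr !mulNr -e2; ring.
have nx : 0 <= 1 - complex.Re (x * conjc x).
  rewrite subr_ge0 mulcJ /= -lecR add_Re2_Im2.
  exact: (exprn_ile1 2 (normr_ge0 x) x1).
have : complex.Re (ip p p) = - (1 - complex.Re (x * conjc x)) * complex.Re (ip u u).
  by rewrite e3 !ReImE inner_self_Im mulr0 subr0 /=.
move=> re; apply: complex_ext; last exact: inner_self_Im.
apply/eqP; rewrite -[complex.Re 0]/(0 : R) eq_le inner_self_ge0 re andbT mulNr oppr_le0 mulr_ge0 //.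
exact: inner_self_ge0.
Qed.

(** * Paraorthogonal polynomials built from orthogonal polynomials *)

Variables (Q : nat -> {poly R[i]}) (b : R[i]) (n : nat).
Hypotheses (hQ : monic_OPUC nu D Q) (b1 : `|b| = 1) (n_gt0 : (0 < n)%N).
Local Notation P := (POPUC n Q b).

Lemma popucE : P = 'X * Q n.-1 - (conjc b)%:P * reversed n.-1 (Q n.-1).
Proof. by []. Qed.

Lemma horner_reversed_conjc (m : nat) q z : (size q <= m.+1)%N -> z != 0 ->
  (reversed m q).[z] = z ^+ m * conjc q.[(conjc z)^-1].
Proof. exact: horner_reversed. Qed.

(** Orthogonality passes from Q to z Q by a shift of the exponents, and to the
    reversed polynomial by conjugation. *)
Lemma popuc_paraorth : paraorth n P.
Proof.
move=> k /andP[k0 kn]; rewrite popucE mul_polyC -scaleNr innerDl innerZl.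
have -> : ip ('X * Q n.-1) 'X^k = 0.
  rewrite (@eq_inner_circle _ _ _ _ _ (Q n.-1) 'X^(k.-1) 1).
    by rewrite opuc_orth ?mulr0 // size_polyXn prednK // -ltnS prednK.
  move=> z z1; rewrite hornerM hornerX !hornerXn -{1}(prednK k0) exprS (rmorphM conjc) /=.
  by rewrite mulrACA norm1_mulcJ.
have -> : ip (reversed n.-1 (Q n.-1)) 'X^k = ip 'X^(n.-1 - k) (Q n.-1).
  rewrite -[RHS]mul1r; apply: eq_inner_circle => z z1.
  have [_ Qs _ _] := hQ n.-1.
  rewrite horner_reversed_conjc ?Qs ?norm1_neq0 // norm1_conjc // invrK hornerXn mul1r hornerXn.
  rewrite mulrAC; congr (_ * _); rewrite rmorphXn /= norm1_conjc //.
  rewrite exprVn; apply: (mulIf (expf_neq0 k (norm1_neq0 z1))).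
  by rewrite divfK ?expf_neq0 ?norm1_neq0 // -exprD subnK // -ltnS prednK.
rewrite inner_conj opuc_orth ?rmorph0 ?mulr0 ?addr0 //.
by rewrite size_polyXn ltn_subrL k0 -ltnS prednK // (leq_ltn_trans k0).
Qed.

Lemma popuc_size : size P = n.+1.
Proof.
have [Qm Qs _ _] := hQ n.-1.
have sXQ : size ('X * Q n.-1) = n.+1.
  by rewrite mulrC size_mulX ?monic_neq0 // Qs prednK.
rewrite popucE size_polyDl // size_polyN sXQ ltnS.
rewrite mul_polyC; apply: (leq_trans (size_scale_leq _ _)).
by apply: (leq_trans (size_poly _ _)); rewrite prednK.
Qed.

Lemma popuc_monic : P \is monic.
Proof.
have [Qm Qs _ _] := hQ n.-1.
have sXQ : size ('X * Q n.-1) = n.+1.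
  by rewrite mulrC size_mulX ?monic_neq0 // Qs prednK.
rewrite monicE popucE lead_coefDl; first by rewrite lead_coefM lead_coefX mul1r -monicE.
rewrite size_polyN sXQ ltnS mul_polyC; apply: (leq_trans (size_scale_leq _ _)).
by apply: (leq_trans (size_poly _ _)); rewrite prednK.
Qed.

Lemma popuc_horner0 : P.[0] = - conjc b.
Proof.
have [Qm Qs _ _] := hQ n.-1.
rewrite popucE hornerD hornerN !hornerM hornerX hornerC mul0r add0r horner_coef0 coef_poly /= subn0.
have -> : (Q n.-1)`_n.-1 = 1 by move/monicP: Qm; rewrite lead_coefE Qs.
by rewrite rmorph1 mulr1.
Qed.

(** The reversal of P, as a polynomial of degree n, is - b P. *)
Lemma popuc_reflected z : z != 0 -> P.[z] = 0 -> P.[(conjc z)^-1] = 0.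
Proof.
move=> z0; have [Qm Qs _ _] := hQ n.-1.
have cz0 : (conjc z) != 0 by rewrite conjc_eq0.
have w0 : (conjc z)^-1 != 0 by rewrite invr_eq0.
rewrite popucE !hornerD !hornerN !hornerM !hornerX !hornerC !horner_reversed_conjc ?Qs //.
rewrite [in X in _ -> X]fmorphV /= conjcK invrK.
move=> /eqP; rewrite subr_eq0 => /eqP e.
have {}e : (conjc z) * (conjc ((Q n.-1).[z])) = b * ((conjc z) ^+ n.-1 * (Q n.-1).[(conjc z)^-1]).
  have : conjc (z * (Q n.-1).[z])
      = conjc (conjc b * (z ^+ n.-1 * conjc (Q n.-1).[(conjc z)^-1])).
    by rewrite e.
  by rewrite !rmorphM /= !conjcK rmorphXn.
have -> : (conjc ((Q n.-1).[z])) = (conjc z)^-1 * (b * ((conjc z) ^+ n.-1 * (Q n.-1).[(conjc z)^-1])).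
  by rewrite -e mulKf.
rewrite exprVn; set q := (Q n.-1).[_].
have bb : b * conjc b = 1 by exact: norm1_mulcJ.
have zn : (conjc z) ^+ n.-1 != 0 by rewrite expf_neq0.
suff key (cz cb u v : R[i]) : cz != 0 -> u != 0 -> b * cb = 1 ->
    cz^-1 * v - cb * (u^-1 * (cz^-1 * (b * (u * v)))) = 0 by exact: key.
move=> h1 h2 h; rewrite (_ : cb * _ = (b * cb) * cz^-1 * v).
  by rewrite h mul1r subrr.
by field; rewrite h1 h2.
Qed.

Hypothesis nu_inf : ~ finite_point_masses nu D.

(** A zero off the circle would come with a distinct reflected zero. *)
Lemma popuc_roots_circle z : P.[z] = 0 -> `|z| = 1.
Proof.
move=> Pz; have z0 : z != 0.
  apply/eqP => z0; move: Pz; rewrite z0 popuc_horner0 => /eqP.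
  by rewrite oppr_eq0 conjc_eq0 (negbTE (norm1_neq0 b1)).
apply/eqP; apply: contraT => nz.
have wz : (conjc z)^-1 != z.
  apply: contra nz => /eqP e; have : z * conjc z = 1 by rewrite -{1}e mulVf // conjc_eq0.
  rewrite mulcJ add_Re2_Im2 => /eqP.
  by rewrite sqrf_eq1 => /orP[//|/eqP e1]; have := normr_ge0 z; rewrite e1 oppr_ge0 ler10.
have /factor_theorem[q Pq] : root P z by rewrite rootE Pz.
have : q.[(conjc z)^-1] = 0.
  have /eqP := popuc_reflected z0 Pz; rewrite Pq !hornerE mulf_eq0 subr_eq0.
  by rewrite (negbTE wz) orbF => /eqP.
move=> /eqP/factor_theorem[r qr].
case: (paraorth_no_reflected_pair (r := r) nu_inf popuc_paraorth popuc_size z0).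
by rewrite Pq qr; ring.
Qed.

Lemma popuc_simple z r : `|z| = 1 -> P <> ('X - z%:P) * ('X - z%:P) * r.
Proof.
move=> z1; have := paraorth_no_reflected_pair (r := r) nu_inf popuc_paraorth popuc_size (norm1_neq0 z1).
by rewrite norm1_conjc // invrK.
Qed.

End Paraorthogonal.

(** * Differentiability of the coefficients *)

Section Coefficients.
Variables (R : realType) (theta0 : R).
Local Open Scope complex_scope.
Local Notation D := (args theta0).

Lemma inner_coef (nu : {finite_measure set (measurableTypeR R) -> \bar R})
    (p q : {poly R[i]}) m : (size p <= m)%N ->
  inner nu D p q = \sum_(j < m) p`_j * inner nu D 'X^j q.
Proof.
move=> sp; rewrite {1}(_ : p = \sum_(j < m) p`_j *: 'X^j).
  by rewrite inner_suml; apply: eq_bigr => j _; rewrite innerZl.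
by rewrite -poly_def; apply/polyP => k; rewrite coef_poly; case: ltnP => // km;
  rewrite nth_default // (leq_trans sp).
Qed.

(** The system satisfied by the coefficients of degree less than n: the first
    row prescribes the value at x, the others express orthogonality. *)
Definition para_mx (nu : {finite_measure set (measurableTypeR R) -> \bar R})
    n (x : R[i]) : 'M[R[i]]_n :=
  \matrix_(i, j) if i == 0%N :> nat then x ^+ j else inner nu D 'X^j 'X^i.

Lemma para_mx_unit (nu : {finite_measure set (measurableTypeR R) -> \bar R}) n (x : R[i]) :
  ~ finite_point_masses nu D -> `|x| <= 1 ->
  (0 < n)%N -> para_mx nu n x \in unitmx.
Proof.
move=> nu_inf x1 n0; rewrite -unitmx_tr -row_free_unit; apply: inj_row_free => v hv.
pose p := \poly_(j < n) (if insub j is Some k then v 0 k else 0).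
have pv (j : 'I_n) : p`_j = v 0 j by rewrite coef_poly ltn_ord valK.
have sp : (size p <= n)%N := size_poly _ _.
have hi (i : 'I_n) : \sum_(j < n) p`_j * para_mx nu n x i j = 0.
  have : (v *m (para_mx nu n x)^T) 0 i = 0 by rewrite hv mxE.
  by rewrite mxE => h; rewrite -[RHS]h; apply: eq_bigr => j _; rewrite [X in _ = _ * X]mxE pv.
suff p0 : p = 0 by apply/rowP => j; rewrite mxE -pv p0 coef0.
apply: (paraorth_eq0 (x := x) nu_inf _ sp x1 _) => [k /andP[k0 kn]|].
  rewrite (inner_coef _ _ sp) -[RHS](hi (Ordinal kn)); apply: eq_bigr => j _.
  by rewrite mxE /= gtn_eqF.
rewrite (horner_coef_wide _ sp) -[RHS](hi (Ordinal n0)); apply: eq_bigr => j _.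
by rewrite mxE.
Qed.

(** A paraorthogonal polynomial is determined by its value at one point of the
    closed disc, through a linear system whose coefficients are moments. *)
Lemma cderivable_paraorth_coef
    (nu : R -> {finite_measure set (measurableTypeR R) -> \bar R})
    (P : R -> {poly R[i]}) (n : nat) (x : R[i]) (y : R -> R[i]) (t : R) :
  (0 < n)%N -> `|x| <= 1 ->
  (forall i j, cderivable (fun u => inner (nu u) D 'X^i 'X^j) t) ->
  cderivable y t ->
  (\near t, [/\ ~ finite_point_masses (nu t) D, paraorth theta0 (nu t) n (P t),
     P t \is monic, size (P t) = n.+1 & (P t).[x] = y t]) ->
  forall k, cderivable (fun u => (P u)`_k) t.
Proof.
move=> n0 x1 hm hy hP k.
have [kn|nk] := ltnP k n; last first.
  apply: (@cderivable_near _ (fun=> (k == n)%:R)); last exact: cderivable_cst.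
  apply: filterS hP => u [_ _ Pm Ps _].
  move: nk; rewrite leq_eqVlt => /predU1P[<-|nk].
    by rewrite eqxx; move/monicP: Pm; rewrite lead_coefE Ps.
  by rewrite gtn_eqF // nth_default // Ps.
pose v u : 'cV[R[i]]_n := \col_i
  if i == 0%N :> nat then y u - x ^+ n else - inner (nu u) D 'X^n 'X^i.
pose c u : 'cV[R[i]]_n := \col_i (P u)`_i.
suff : cderivable (fun u => c u (Ordinal kn) 0) t.
  by rewrite (_ : (fun u => _) = (fun u => (P u)`_k)) //; apply/funext => u; rewrite mxE.
apply: (@cderivable_linear_system _ _ (fun u => para_mx (nu u) n x) c v).
- move=> i j; under eq_fun do rewrite mxE.
  by case: (nat_of_ord i == 0%N); [exact: cderivable_cst|exact: hm].
- move=> i; under eq_fun do rewrite mxE.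
  case: (nat_of_ord i == 0%N); last exact: (cderivableN (hm _ _)).
  exact: (cderivableD hy (cderivable_cst _ _)).
apply: filterS hP => u [nu_inf Po Pm Ps Py]; split; first exact: para_mx_unit.
have Pn : (P u)`_n = 1 by move/monicP: Pm; rewrite lead_coefE Ps.
have sP : (size (P u) <= n.+1)%N by rewrite Ps.
apply/colP => i; rewrite !mxE.
under eq_bigr do rewrite !mxE mulrC.
case: ifP => i0.
  rewrite -Py (horner_coef_wide _ sP) big_ord_recr /= Pn mul1r addrK.
  by apply: eq_bigr => j _.
apply/eqP; rewrite -addr_eq0; apply/eqP.
transitivity (inner (nu u) D (P u) 'X^i); last by rewrite Po // ltn_ord andbT lt0n i0.
by rewrite (inner_coef _ _ sP) big_ord_recr /= Pn mul1r.
Qed.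

End Coefficients.

(** * Integral functionals on bounded measurable functions *)

Section BoundedFunctionals.
Context d (T : measurableType d) (R : realType).
Implicit Types (g : T -> R) (Phi Psi : (T -> R) -> R).

Definition bounded_measurable g : Prop :=
  measurable_fun setT g /\ exists M, forall x, `|g x| <= M.

Lemma bounded_measurable_cst (c : R) : bounded_measurable (fun=> c).
Proof. by split; [exact: measurable_cst|exists `|c|]. Qed.

Lemma bounded_measurableD g1 g2 : bounded_measurable g1 -> bounded_measurable g2 ->
  bounded_measurable (fun x => g1 x + g2 x).
Proof.
move=> [m1 [M1 b1]] [m2 [M2 b2]]; split; first exact: measurable_funD.
by exists (M1 + M2) => x; apply: (le_trans (ler_normD _ _)); apply: lerD.
Qed.

Lemma bounded_measurableM g1 g2 : bounded_measurable g1 -> bounded_measurable g2 ->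
  bounded_measurable (fun x => g1 x * g2 x).
Proof.
move=> [m1 [M1 b1]] [m2 [M2 b2]]; split; first exact: measurable_funM.
by exists (M1 * M2) => x; rewrite normrM; apply: ler_pM.
Qed.

Lemma bounded_measurable_indic (A : set T) : measurable A ->
  bounded_measurable (\1_A : T -> R).
Proof.
move=> mA; split; first exact: measurable_indic.
by exists 1 => x; rewrite indicE; case: (_ \in _); rewrite /= ?normr1 ?normr0 ?ler01.
Qed.

Lemma bounded_measurable_sum (I : Type) (s : seq I) (g : I -> T -> R) :
  (forall i, bounded_measurable (g i)) ->
  bounded_measurable (fun x => \sum_(i <- s) g i x).
Proof.
move=> h; elim: s => [|i s IH].
  by under eq_fun do rewrite big_nil; exact: bounded_measurable_cst.
under eq_fun do rewrite big_cons; exact: (bounded_measurableD (h i) IH).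
Qed.

(** What integration against a signed measure retains. Such functionals agree as
    soon as they agree on indicators; the masses gamma_j may be negative, since
    mu itself may charge the mass points, so that the theory of integration
    against a sum of positive measures does not apply to them. *)
Record integral_functional Phi : Prop := IntegralFunctional {
  ifunD : forall g1 g2, bounded_measurable g1 -> bounded_measurable g2 ->
    Phi (fun x => g1 x + g2 x) = Phi g1 + Phi g2 ;
  ifunZ : forall c g, bounded_measurable g -> Phi (fun x => c * g x) = c * Phi g ;
  ifun_cvg : forall (g_ : nat -> T -> R) g M, (forall n, bounded_measurable (g_ n)) ->
    bounded_measurable g -> (forall n x, `|g_ n x| <= M) ->
    (forall x, g_ n x @[n --> \oo] --> g x) ->
    Phi (g_ n) @[n --> \oo] --> Phi g }.

Lemma ifun_sum Phi (I : Type) (s : seq I) (g : I -> T -> R) :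
  integral_functional Phi -> (forall i, bounded_measurable (g i)) ->
  Phi (fun x => \sum_(i <- s) g i x) = \sum_(i <- s) Phi (g i).
Proof.
move=> hP h; elim: s => [|i s IH].
  under eq_fun do rewrite big_nil.
  rewrite big_nil -[X in Phi X](_ : (fun x => 0 * 0) = _).
    by rewrite (ifunZ hP) ?mul0r //; exact: bounded_measurable_cst.
  by apply/funext => x; rewrite mul0r.
rewrite big_cons -IH -(ifunD hP) //; last exact: bounded_measurable_sum.
by congr Phi; apply/funext => x; rewrite big_cons.
Qed.

Lemma integral_functionalD Phi Psi : integral_functional Phi ->
  integral_functional Psi -> integral_functional (fun g => Phi g + Psi g).
Proof.
move=> h1 h2; split=> [g1 g2 b1 b2|c g b|g_ g M b_ b bM gg].
- by rewrite (ifunD h1) // (ifunD h2) // addrACA.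
- by rewrite (ifunZ h1) // (ifunZ h2) // mulrDr.
- by apply: cvgD; [exact: (ifun_cvg h1) bM gg|exact: (ifun_cvg h2) bM gg].
Qed.

Lemma integral_functional_point (c : R) (a : T) :
  integral_functional (fun g => c * g a).
Proof.
split=> [g1 g2 b1 b2|e g b|g_ g M b_ b bM gg].
- by rewrite mulrDr.
- by rewrite mulrCA.
- by apply: cvgM; [exact: cvg_cst|exact: gg].
Qed.

Lemma integral_functional_sum (I : Type) (s : seq I) (Phi : I -> (T -> R) -> R) :
  (forall i, integral_functional (Phi i)) ->
  integral_functional (fun g => \sum_(i <- s) Phi i g).
Proof.
move=> h; elim: s => [|i s IH].
  under eq_fun do rewrite big_nil.
  by split=> [g1 g2 b1 b2|c g b|g_ g M b_ b bM gg];
    rewrite ?addr0 ?mulr0 //; exact: cvg_cst.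
under eq_fun do rewrite big_cons; exact: (integral_functionalD (h i) IH).
Qed.

Lemma bounded_mul_integrable (m : {measure set T -> \bar R}) (A : set T) (h g : T -> R) :
  measurable A -> m.-integrable A (EFin \o h) -> bounded_measurable g ->
  m.-integrable A (EFin \o (fun x => g x * h x)).
Proof.
move=> mA ih [mg [M b]].
have : m.-integrable A ((EFin \o g) \* (EFin \o h))%E.
  apply: integrableMr => //; first exact: measurable_funTS.
  exists M; split; first exact: num_real.
  by move=> y My x _ /=; apply: (le_trans (b x)); exact: ltW.
by [].
Qed.

Lemma integral_functional_integral (m : {measure set T -> \bar R}) (A : set T)
    (h : T -> R) : measurable A -> m.-integrable A (EFin \o h) ->
  integral_functional (fun g => \int[m]_(x in A) (g x * h x)).
Proof.
move=> mA ih; split=> [g1 g2 b1 b2|c g b|g_ g M b_ b bM gg].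
- rewrite -RintegralD //; try exact: bounded_mul_integrable.
  by apply: eq_Rintegral => x _; rewrite mulrDl.
- rewrite -RintegralZl //; try exact: bounded_mul_integrable.
  by apply: eq_Rintegral => x _; rewrite mulrA.
have ig_ n := bounded_mul_integrable mA ih (b_ n).
have ig := bounded_mul_integrable mA ih b.
have iM : m.-integrable A (EFin \o (fun x => M * `|h x|)).
  apply: (@bounded_mul_integrable _ _ (fun x => `|h x|)) => //.
    exact: (integrable_abse ih).
  exact: bounded_measurable_cst.
have M0 (x : T) : 0 <= M by apply: le_trans (bM 0%N x).
have [_ _ cv] := @dominated_convergence _ _ _ m A mA
  (fun n x => (g_ n x * h x)%:E) (fun x => (g x * h x)%:E)
  (EFin \o (fun x => M * `|h x|)) (fun n => measurable_int _ (ig_ n))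
  (measurable_int _ ig) ltac:(apply: aeW => x _; apply/cvg_EFin;
    [exact: nearW|by apply: cvgM; [exact: gg|exact: cvg_cst]]) iM
  ltac:(by apply: aeW => x n _; rewrite /= lee_fin normrM ler_wpM2r).
apply: fine_cvg; rewrite fineK; first exact: cv.
exact: integrable_fin_num ig.
Qed.

Import HBNNSimple.

(** Simple functions increase to g. *)
Lemma ge0_integral_functional_eq Phi Psi g :
  integral_functional Phi -> integral_functional Psi ->
  (forall A, measurable A -> Phi (\1_A) = Psi (\1_A)) ->
  bounded_measurable g -> (forall x, 0 <= g x) -> Phi g = Psi g.
Proof.
move=> hP hS e [mg [M b]] g0.
have mEg : measurable_fun setT (EFin \o g) by exact/measurable_EFinP.
pose k n := nnsfun_approx measurableT mEg n.
have kg n x : 0 <= k n x <= g x.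
  apply/andP; split => //; rewrite -lee_fin /k nnsfun_approxE.
  by apply: (@le_approx _ _ _ _ (EFin \o g)) => // y _; rewrite lee_fin.
have bk n : bounded_measurable (k n).
  split; first exact: measurable_funP.
  exists M => x; have /andP[k0 kx] := kg n x.
  by rewrite ger0_norm // (le_trans kx) // (le_trans (ler_norm _)).
have kM n x : `|k n x| <= M.
  have /andP[k0 kx] := kg n x.
  by rewrite ger0_norm // (le_trans kx) // (le_trans (ler_norm _)).
have kc x : k n x @[n --> \oo] --> g x.
  have g0' y : setT y -> (0 <= (EFin \o g) y)%E by rewrite lee_fin.
  exact: (fine_cvg (cvg_nnsfun_approx measurableT mEg g0' (x := x) I)).
have ek n : Phi (k n) = Psi (k n).
  have -> : (k n : T -> R) =
      (fun x => \sum_(y <- finmap.enum_fset (fset_set (range (k n)))) y * \1_(k n @^-1` [set y]) x).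
    by apply/funext => x; rewrite fimfunE fsbig_finite.
  have mi y : measurable (k n @^-1` [set y]) by exact: measurable_sfunP.
  have bi y : bounded_measurable (\1_(k n @^-1` [set y]) : T -> R).
    exact: bounded_measurable_indic.
  have bci y : bounded_measurable (fun x => y * \1_(k n @^-1` [set y]) x : R).
    by apply: bounded_measurableM => //; exact: bounded_measurable_cst.
  rewrite (ifun_sum _ hP) // (ifun_sum _ hS) //.
  by apply: eq_bigr => y _; rewrite (ifunZ hP) // (ifunZ hS) // e.
have bg : bounded_measurable g by split => //; exists M.
have c1 := ifun_cvg hP bk bg kM kc; have c2 := ifun_cvg hS bk bg kM kc.
have ekf : (fun n => Psi (k n)) = (fun n => Phi (k n)) by apply/funext => n; rewrite ek.
rewrite ekf in c2; exact: (cvg_unique _ c1 c2).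
Qed.

Lemma integral_functional_eq Phi Psi g :
  integral_functional Phi -> integral_functional Psi ->
  (forall A, measurable A -> Phi (\1_A) = Psi (\1_A)) ->
  bounded_measurable g -> Phi g = Psi g.
Proof.
move=> hP hS e bg; have [mg [M b]] := bg.
have bM := bounded_measurable_cst M.
have -> : g = (fun x => (g x + M) + (-1) * M) by apply/funext => x; ring.
have bgM := bounded_measurableD bg bM.
have bN : bounded_measurable (fun=> -1 * M) by exact: bounded_measurable_cst.
rewrite (ifunD hP) // (ifunD hS) // (ifunZ hP) // (ifunZ hS) //.
rewrite (ge0_integral_functional_eq hP hS e bgM).
  by rewrite (ge0_integral_functional_eq hP hS e bM) // => x; apply: (le_trans _ (b x)).
by move=> x; have := b x; rewrite ler_norml => /andP[h _]; rewrite -lerBlDr sub0r.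
Qed.

End BoundedFunctionals.

(** * A weighted measure with moving point masses *)

Section WeightedMeasure.
Variables (R : realType) (J : set R) (theta0 : R) (N : nat).
Variable mu : {measure set (measurableTypeR R) -> \bar R}.
Variables (w : R -> R -> \bar R) (gamma omega : 'I_N.+1 -> R -> R).
Variable nu : R -> {finite_measure set (measurableTypeR R) -> \bar R}.
Variable alpha : R -> R.
Local Notation D := (args theta0).
Local Notation mD := (@measurable_args R theta0).

(** Off a null set the almost everywhere hypotheses hold at every point; the last
    clause lets the remaining set replace the circle as a domain of integration. *)
Definition regular_set (E : set (measurableTypeR R)) : Prop :=
  [/\ measurable E /\ E `<=` D, mu.-integrable E (EFin \o alpha),
    (forall theta t, E theta -> J t -> [/\ 0 <= fine (w theta t),
       derivable (fun u => fine (w theta u)) t 1 &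
       `|dt_weight w theta t| <= alpha theta]),
    (forall t, J t -> mu.-integrable E (EFin \o (fun theta => fine (w theta t)))) &
    (forall t, J t -> forall g : measurableTypeR R -> R, bounded_measurable g ->
       \int[nu t]_(theta in D) g theta
       = \int[mu]_(theta in E) (g theta * fine (w theta t))
         + \sum_(j < N.+1) gamma j t * g (omega j t))].

Hypothesis w_meas : forall t, J t -> measurable_fun (args theta0)
  (fun theta : measurableTypeR R => w theta t).
Hypothesis w_ge0 : forall theta t, args theta0 theta -> J t -> (0 <= w theta t)%E.
Hypothesis omega_arc : forall j t, J t -> args theta0 (omega j t).
Hypothesis nuE : forall t, J t ->
  forall A : set (measurableTypeR R), measurable A ->
    nu t A = (\int[mu]_(theta in A `&` args theta0) w theta t
              + \sum_(j < N.+1) (gamma j t)%:E * \d_(omega j t) A)%E.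
Hypothesis w_diff : {ae mu, forall theta, args theta0 theta -> forall t, J t ->
  w theta t \is a fin_num /\ derivable (fun u => fine (w theta u)) t 1}.
Hypothesis alpha_int : mu.-integrable (args theta0) (fun theta => (alpha theta)%:E).
Hypothesis w_dom : {ae mu, forall theta, args theta0 theta -> forall t, J t ->
  `|dt_weight w theta t| <= alpha theta}.

Let sum_fin t (A : set R) :
  (\sum_(j < N.+1) (gamma j t)%:E * \d_(omega j t) A)%E
  = (\sum_(j < N.+1) gamma j t * \1_A (omega j t))%:E.
Proof. by rewrite -sumEFin; apply: eq_bigr => j _. Qed.

Let w_int t : J t -> mu.-integrable D (fun theta => w theta t).
Proof.
move=> Jt; apply/integrableP; split; first exact: w_meas.
have -> : (\int[mu]_(x in D) `|w x t| = \int[mu]_(x in D) w x t)%E.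
  by apply: eq_integral => x; rewrite inE => Dx; rewrite gee0_abs // w_ge0.
have := nuE Jt measurableT; rewrite setTI sum_fin => e.
have f : (nu t setT \is a fin_num)%E by exact: fin_num_measure.
have i0 : (0 <= \int[mu]_(x in D) w x t)%E.
  by apply: integral_ge0 => x Dx; exact: w_ge0.
by move: f; rewrite e; case: (integral _ _ _) i0 => //= r _ _; rewrite ltry.
Qed.

Lemma exists_regular_set : exists E, regular_set E.
Proof.
have [M [mM M0 sM]] := filterI w_diff w_dom.
pose E : set (measurableTypeR R) := D `\` M.
have mE : measurable E by exact: measurableD mD mM.
have ED : E `<=` D by move=> x [].
have good x : E x -> (forall t, J t -> w x t \is a fin_num
    /\ derivable (fun u => fine (w x u)) t 1)
    /\ (forall t, J t -> `|dt_weight w x t| <= alpha x).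
  move=> [Dx Mx]; have : ~ (~ ((D x -> forall t, J t -> w x t \is a fin_num
    /\ derivable (fun u => fine (w x u)) t 1)
    /\ (D x -> forall t, J t -> `|dt_weight w x t| <= alpha x))).
    by move=> h; apply: Mx; apply: sM.
  by move=> /contrapT [h1 h2]; split => t Jt; [exact: h1|exact: h2].
have wE x t : E x -> J t -> (fine (w x t))%:E = w x t.
  by move=> Ex Jt; rewrite fineK //; have [h _] := good x Ex; have [] := h t Jt.
have iE t : J t -> mu.-integrable E (EFin \o (fun x => fine (w x t))).
  move=> Jt; apply: (@eq_integrable _ _ _ mu E mE (fun x => w x t)).
    by move=> x; rewrite inE => Ex; rewrite /= wE.
  exact: (integrableS mD mE ED (w_int Jt)).
exists E; split => //.
- exact: (integrableS mD mE ED alpha_int).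
- move=> x t Ex Jt; have [h1 h2] := good x Ex; have [f d] := h1 t Jt.
  split; [|exact: d|exact: h2].
  by rewrite -lee_fin wE //; apply: w_ge0 => //; exact: ED.
move=> t Jt g bg.
pose Phi g := \int[nu t]_(x in D) (g x * 1).
pose Psi (g : measurableTypeR R -> R) := \int[mu]_(x in E) (g x * fine (w x t))
         + \sum_(j < N.+1) gamma j t * g (omega j t).
have hP : integral_functional Phi.
  apply: (integral_functional_integral mD).
  exact: (bdiff_integrable (nu t) mD (bdiff_cst 1)).
have hS : integral_functional Psi.
  apply: integral_functionalD; first exact: (integral_functional_integral mE (iE t Jt)).
  by apply: integral_functional_sum => j; exact: integral_functional_point.
transitivity (Phi g); first by apply: eq_Rintegral => x _; rewrite mulr1.
apply: (integral_functional_eq hP hS) bg => A mA.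
have mAD : measurable (A `&` D) by exact: measurableI mA mD.
have mAE : measurable (A `&` E) by exact: measurableI mA mE.
have -> : Phi \1_A = fine (nu t (A `&` D)).
  rewrite /Phi; under eq_Rintegral do rewrite mulr1.
  by rewrite /Rintegral (integral_indic _ mD).
rewrite nuE // -setIA setIid sum_fin.
have -> : (\int[mu]_(x in A `&` D) w x t)%E = (\int[mu]_(x in A `&` E) (fine (w x t))%:E)%E.
  rewrite (negligible_integral mM mAD _ M0).
    have -> : (A `&` D) `\` M = A `&` E.
      by apply/seteqP; split => x /= [] => [[]|] ? => [?|[]]; do ?split.
    apply: eq_integral => x; rewrite inE => -[Ax [Dx Mx]].
    by rewrite wE.
  by apply: (integrableS mD mAD _ (w_int Jt)) => x [].
have fA : (\int[mu]_(x in A `&` E) (fine (w x t))%:E)%E \is a fin_num.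
  apply: integrable_fin_num => //.
  by apply: (integrableS mE mAE _ (iE t Jt)) => x [].
rewrite fineD // /Psi; congr (_ + _).
  rewrite /Rintegral; congr fine.
  rewrite setIC integral_mkcondr; apply: eq_integral => x _.
  by rewrite epatch_indic /= -EFinM mulrC.
apply: eq_bigr => j _; rewrite !indicE in_setI.
by rewrite (mem_set (omega_arc j Jt)) andbT.
Qed.

End WeightedMeasure.

Section DerivativeOfMoments.
Variables (R : realType) (J : set R) (theta0 : R) (N : nat).
Variable mu : {measure set (measurableTypeR R) -> \bar R}.
Variables (w : R -> R -> \bar R) (gamma omega : 'I_N.+1 -> R -> R).
Variable nu : R -> {finite_measure set (measurableTypeR R) -> \bar R}.
Variable alpha : R -> R.
Variable E : set (measurableTypeR R).
Local Notation D := (args theta0).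
Local Notation mD := (@measurable_args R theta0).
Hypothesis J_open : open J.
Hypothesis gamma_diff : forall j t, J t -> derivable (gamma j) t 1.
Hypothesis omega_diff : forall j t, J t -> derivable (omega j) t 1.
Hypothesis regE : regular_set J theta0 mu w gamma omega nu alpha E.

Lemma bdiff_bounded_measurable (g : measurableTypeR R -> R) :
  bdiff g -> bounded_measurable g.
Proof. by move=> bg; split; [exact: bdiff_measurable|case: bg]. Qed.

(** The derivative of the integral of a fixed function g against nu t: the weight
    varies under the integral sign, each mass varies in size and in position. *)
Definition dt_integral (g : R -> R) (t : R) : R :=
  \int[mu]_(theta in E) (g theta * dt_weight w theta t)
  + \sum_(j < N.+1) (derive1 (gamma j) t * g (omega j t)
      + gamma j t * (derive1 g (omega j t) * derive1 (omega j) t)).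

Lemma derivable_is_derive1 (f : R -> R) (t : R) :
  derivable f t 1 -> is_derive t 1 f (derive1 f t).
Proof. by move=> d; apply: (DeriveDef d); rewrite derive1E. Qed.

Lemma is_derive_integral (g : R -> R) (t : R) : J t -> bdiff g ->
  is_derive t 1 (fun u => \int[nu u]_(theta in D) g theta) (dt_integral g t).
Proof.
move=> Jt bg; have [[mE ED] ialpha hE iw formula] := regE.
pose F u := \int[mu]_(theta in E) (g theta * fine (w theta u)).
pose S u := \sum_(j < N.+1) gamma j u * g (omega j u).
have bmg := bdiff_bounded_measurable bg.
have [e /= e0 eJ] : nbhs_ball t J by apply/nbhs_ballP; exact: open_nbhs_nbhs.
have IJ x : (`]t - e, t + e[%classic : set R) x -> J x.
  rewrite /= in_itv /= => /andP[h1 h2]; apply: eJ.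
  by rewrite /ball /= ltr_norml; apply/andP; split; lra.
have It : (`]t - e, t + e[%classic : set R) t by rewrite /= in_itv /=; apply/andP; split; lra.
have [dg [M bM]] := bg.
pose G y := M * `|alpha y|.
have M0 : 0 <= M by apply: le_trans (bM 0).
have dF x y : (`]t - e, t + e[%classic : set R) x -> E y ->
    is_derive x 1 (fun u => g y * fine (w y u)) (g y * dt_weight w y x).
  move=> Ix Ey; have [_ d _] := hE y x Ey (IJ x Ix).
  apply: is_derive_val (is_deriveM (is_derive_cst (g y) x 1) (derivable_is_derive1 d)).
  by rewrite /GRing.scale /= mulr0 addr0.
have G0 y : 0 <= G y by rewrite mulr_ge0.
have iG : mu.-integrable E (EFin \o G).
  exact: (bounded_mul_integrable (g := fun=> M) mE (integrable_abse ialpha)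
    (bounded_measurable_cst _ M)).
have int_f x : (`]t - e, t + e[%classic : set R) x ->
    mu.-integrable E (EFin \o (fun y => g y * fine (w y x))).
  by move=> Ix; apply: bounded_mul_integrable => //; exact: iw (IJ x Ix).
have der x y : (`]t - e, t + e[%classic : set R) x -> E y ->
    derivable (fun u => g y * fine (w y u)) x 1.
  by move=> Ix Ey; have [] := dF x y Ix Ey.
have p1 x y : (`]t - e, t + e[%classic : set R) x -> E y ->
    derive1 (fun u => g y * fine (w y u)) x = g y * dt_weight w y x.
  by move=> Ix Ey; rewrite derive1E; have [] := dF x y Ix Ey.
have ub x y : (`]t - e, t + e[%classic : set R) x -> E y ->
    `|derive1 (fun u => g y * fine (w y u)) x| <= G y.
  move=> Ix Ey; rewrite p1 // normrM; apply: ler_pM => //.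
  by have [_ _ h] := hE y x Ey (IJ x Ix); apply: (le_trans h); exact: ler_norm.
have hF : is_derive t 1 F (\int[mu]_(theta in E) (g theta * dt_weight w theta t)).
  have dFt := @derivable_under_integral _ _ _ mu (fun u y => g y * fine (w y u))
    E mE t (t - e) (t + e) It int_f der G G0 iG ub.
  apply: (DeriveDef dFt); rewrite -derive1E.
  rewrite (@differentiation_under_integral _ _ _ mu (fun u y => g y * fine (w y u))
    E mE t (t - e) (t + e) It int_f der G G0 iG ub).
  by apply: eq_Rintegral => y; rewrite inE => Ey; exact: p1.
have hS : is_derive t 1 S (\sum_(j < N.+1) (derive1 (gamma j) t * g (omega j t)
      + gamma j t * (derive1 g (omega j t) * derive1 (omega j) t))).
  have hj (j : 'I_N.+1) : is_derive t 1 (fun u => gamma j u * g (omega j u))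
    (derive1 (gamma j) t * g (omega j t)
      + gamma j t * (derive1 g (omega j t) * derive1 (omega j) t)).
    have hg := derivable_is_derive1 (@gamma_diff j t Jt).
    have ho := is_derive1_comp (derivable_is_derive1 (dg (omega j t)))
       (derivable_is_derive1 (@omega_diff j t Jt)).
    apply: is_derive_val (is_deriveM hg ho).
    by rewrite /GRing.scale /= addrC [g _ * _]mulrC.
  rewrite (_ : S = \sum_(j < N.+1) (fun u => gamma j u * g (omega j u))).
    exact: is_derive_sum hj.
  by apply/funext => u; rewrite fct_sumE.
apply: near_eq_is_derive (is_deriveD hF hS).
have : \forall u \near t, J u by exact: open_nbhs_nbhs.
by apply: filterS => u Ju; rewrite formula.
Qed.

Local Open Scope complex_scope.

Definition cdt_integral (f : R -> R[i]) (t : R) : R[i] :=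
  dt_integral (fun x => complex.Re (f x)) t +i*
  dt_integral (fun x => complex.Im (f x)) t.

Lemma is_cderive_integral (f : R -> R[i]) (t : R) : J t -> cbdiff f ->
  is_cderive (fun u => cintegral (nu u) D f) t (cdt_integral f t).
Proof. by move=> Jt [h1 h2]; split; exact: is_derive_integral. Qed.

(** Linearity is inherited from that of the integral, by uniqueness of the
    derivative. *)
Lemma cdt_integralZ (c : R[i]) (f : R -> R[i]) t : J t -> cbdiff f ->
  cdt_integral (fun x => c * f x) t = c * cdt_integral f t.
Proof.
move=> Jt hf; have hcf := cbdiffM (cbdiff_cst c) hf.
apply: is_cderive_unique (is_cderive_integral Jt hcf) _.
under eq_fun do rewrite (cintegralZ _ mD _ hf).
apply: is_cderive_val (is_cderiveM (is_cderive_cst c t) (is_cderive_integral Jt hf)).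
by rewrite mul0r add0r.
Qed.

Lemma is_cderive_inner (p q : {poly R[i]}) (t : R) : J t ->
  is_cderive (fun u => inner (nu u) D p q) t
    (cdt_integral (fun x => p.[expi x] * conjc q.[expi x]) t).
Proof. by move=> Jt; exact: (is_cderive_integral Jt (cbdiff_inner p q)). Qed.

End DerivativeOfMoments.

(** * Limits of complex-valued functions *)

Section ComplexLimits.
Variable R : realType.
Local Open Scope complex_scope.

Definition ccvg (T : Type) (F : set_system T) (f : T -> R[i]) (l : R[i]) : Prop :=
  (complex.Re (f x) @[x --> F] --> complex.Re l) /\
  (complex.Im (f x) @[x --> F] --> complex.Im l).

Section Filter.
Variables (T : Type) (F : set_system T).
Context {FF : Filter F}.
Implicit Types (f g : T -> R[i]).

Lemma ccvg_cst l : ccvg F (fun=> l) l.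
Proof. by split; exact: cvg_cst. Qed.

Lemma ccvgD f g l m : ccvg F f l -> ccvg F g m -> ccvg F (fun x => f x + g x) (l + m).
Proof.
by move=> [f1 f2] [g1 g2]; split; rewrite ReImE; under eq_fun do rewrite ReImE;
  exact: cvgD.
Qed.

Lemma ccvgM f g l m : ccvg F f l -> ccvg F g m -> ccvg F (fun x => f x * g x) (l * m).
Proof.
move=> [f1 f2] [g1 g2]; split; rewrite ReImE; under eq_fun do rewrite ReImE.
  by apply: cvgB; exact: cvgM.
by apply: cvgD; exact: cvgM.
Qed.

Lemma ccvgX f l n : ccvg F f l -> ccvg F (fun x => f x ^+ n) (l ^+ n).
Proof.
move=> h; elim: n => [|n IH]; first exact: ccvg_cst.
by under eq_fun do rewrite exprS; rewrite exprS; exact: ccvgM.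
Qed.

Lemma ccvg_sum (I : Type) (r : seq I) (f : I -> T -> R[i]) (l : I -> R[i]) :
  (forall i, ccvg F (f i) (l i)) ->
  ccvg F (fun x => \sum_(i <- r) f i x) (\sum_(i <- r) l i).
Proof.
move=> h; elim: r => [|i r IH].
  by under eq_fun do rewrite big_nil; rewrite big_nil; exact: ccvg_cst.
by under eq_fun do rewrite big_cons; rewrite big_cons; exact: ccvgD.
Qed.

Lemma norm_Re_le (z : R[i]) : `|complex.Re z|%:C <= `|z|.
Proof.
rewrite normc_def lecR -sqrtr_sqr ler_wsqrtr // lerDl; exact: sqr_ge0.
Qed.

Lemma norm_Im_le (z : R[i]) : `|complex.Im z|%:C <= `|z|.
Proof.
rewrite normc_def lecR -sqrtr_sqr ler_wsqrtr // lerDr; exact: sqr_ge0.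
Qed.

Lemma norm_le_ReIm (z : R[i]) : `|z| <= (`|complex.Re z| + `|complex.Im z|)%:C.
Proof.
rewrite normc_def lecR -(@ler_pXn2r _ 2) ?nnegrE ?sqrtr_ge0 ?addr_ge0 //.
rewrite sqr_sqrtr ?addr_ge0 ?sqr_ge0 // sqrrD !real_normK ?num_real //.
by rewrite -addrA lerD2l lerDr mulrn_wge0 // mulr_ge0.
Qed.

Lemma ccvg_normP f l :
  ccvg F f l <-> forall e : R, 0 < e -> \forall x \near F, `|f x - l| < e%:C.
Proof.
split=> [[f1 f2] e e0|h].
  have e2 : 0 < e / 2 by rewrite divr_gt0.
  move/cvgrPdist_lt/(_ _ e2): f1 => f1; move/cvgrPdist_lt/(_ _ e2): f2 => f2.
  near=> x; apply: (le_lt_trans (norm_le_ReIm _)); rewrite ltcR !ReImE.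
  rewrite [e]splitr; apply: ltrD; rewrite distrC; near: x; first exact: f1.
  exact: f2.
split; apply/cvgrPdist_lt => e e0; have := h e e0; apply: filterS => x fx;
  rewrite distrC -ltcR; apply: le_lt_trans fx.
  by have := norm_Re_le (f x - l); rewrite !ReImE.
by have := norm_Im_le (f x - l); rewrite !ReImE.
Unshelve. all: by end_near. Qed.

Lemma ccvg_neq0 f l : ccvg F f l -> l != 0 -> \forall x \near F, f x != 0.
Proof.
move=> /ccvg_normP h l0.
have l1 : 0 < complex.Re `|l|.
  by rewrite -ltcR RRe_real ?normr_real // normr_gt0.
apply: filterS (h _ l1) => x; rewrite RRe_real ?normr_real //.
by apply: contraTneq => ->; rewrite sub0r normrN ltxx.
Qed.

End Filter.

Lemma cderivable_ccvg (f : R -> R[i]) t : cderivable f t -> ccvg (nbhs t) f (f t).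
Proof.
move=> [d1 d2]; split.
  by have := differentiable_continuous ((derivable1_diffP _ _).1 d1).
by have := differentiable_continuous ((derivable1_diffP _ _).1 d2).
Qed.

Lemma ccvgV (f : R -> R[i]) t : ccvg (nbhs t) f (f t) -> f t != 0 ->
  ccvg (nbhs t) (fun u => (f u)^-1) (f t)^-1.
Proof.
move=> h f0; rewrite invcE; under eq_fun do rewrite invcE.
have hc : ccvg (nbhs t) (fun u => conjc (f u)) (conjc (f t)).
  case: h => h1 h2; split; under eq_fun do rewrite ReImE; rewrite ReImE; first exact: h1.
  exact: cvgN.
apply: (ccvgM hc); have [h1 _] := ccvgM h hc.
split => /=; last exact: cvg_cst.
by apply: cvgV h1; rewrite Re_mulcJ_eq0.
Qed.

(** At a zero of f, the difference quotient of f g is that of f times g. *)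
Lemma derivable_mul_root (f g : R -> R) (t : R) : derivable f t 1 -> f t = 0 ->
  g u @[u --> t] --> g t -> derivable (fun u => f u * g u) t 1.
Proof.
move=> df f0 gc; have gs : g (h *: 1 + t) @[h --> 0^'] --> g t.
  apply: (@cvg_comp _ _ _ (fun h : R => h *: 1 + t) g _ _ _ _ gc).
  have c0 : h *: 1 + t @[h --> (0:R)] --> t.
    apply/cvgrPdist_lt => e e0; exists e => // h; rewrite /= sub0r normrN => he.
    by rewrite [h *: 1]mulr1 opprD addrCA subrr addr0 normrN.
  by move=> A /c0; apply: (@filterS _ (nbhs (0:R))) => h hA _.
have c := cvgM df gs; rewrite /derivable.
have -> : (fun h : R => h^-1 *: (((fun u => f u * g u) \o shift t) (h *: 1) - f t * g t))
    = (fun h => h^-1 *: ((f \o shift t) (h *: 1) - f t) * g (h *: 1 + t)).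
  by apply/funext => h; rewrite /= f0 mul0r !subr0 /GRing.scale /= mulrA.
by apply/cvg_ex; eexists; exact: c.
Qed.

Lemma cderivable_mul_root (f g : R -> R[i]) t : cderivable f t -> f t = 0 ->
  ccvg (nbhs t) g (g t) -> cderivable (fun u => f u * g u) t.
Proof.
move=> [d1 d2] f0 [g1 g2]; have [r0 i0] : complex.Re (f t) = 0 /\ complex.Im (f t) = 0.
  by rewrite f0.
split; under eq_fun do rewrite ReImE.
  exact: (derivableB (derivable_mul_root d1 r0 g1) (derivable_mul_root d2 i0 g2)).
exact: (derivableD (derivable_mul_root d1 r0 g2) (derivable_mul_root d2 i0 g1)).
Qed.

End ComplexLimits.

(** * A simple zero moves differentiably *)

Section SimpleZero.
Variable R : realType.
Local Open Scope complex_scope.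
Implicit Types (p : {poly R[i]}) (x y z : R[i]) (n : nat).

Definition cnbhs z : set_system R[i] :=
  [set A | exists2 d : R, 0 < d & forall x, `|x - z| < d%:C -> A x].

Global Instance cnbhs_filter z : Filter (cnbhs z).
Proof.
split=> [|A B [d d0 dA] [e e0 eB]|A B AB [d d0 dA]]; first by exists 1.
  exists (Num.min d e); first by rewrite lt_min d0.
  move=> x xz; split; [apply: dA|apply: eB]; apply: (lt_le_trans xz);
    by rewrite lecR ge_min lexx ?orbT.
by exists d => // x /dA/AB.
Qed.

Lemma ccvg_cnbhs z : ccvg (cnbhs z) id z.
Proof. by apply/ccvg_normP => e e0; exists e. Qed.

Lemma ccvg_comp (T U : Type) (F : set_system T) (G : set_system U) (g : T -> U)
    (f : U -> R[i]) l :
  (g @ F --> G) -> ccvg G f l -> ccvg F (f \o g) l.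
Proof. by move=> gF [h1 h2]; split; [exact: (cvg_comp _ _ gF h1)|exact: (cvg_comp _ _ gF h2)]. Qed.

(** The quotient (p(x) - p(y)) / (x - y), written without division so that it is
    continuous across x = y. *)
Definition divdiff n p x y : R[i] :=
  \sum_(i < n.+1) p`_i * \sum_(j < i) x ^+ (i.-1 - j) * y ^+ j.

Lemma divdiffP n p x y : (size p <= n.+1)%N ->
  p.[x] - p.[y] = (x - y) * divdiff n p x y.
Proof.
move=> sp; rewrite !(horner_coef_wide _ sp) -sumrB mulr_sumr; apply: eq_bigr => i _.
by rewrite -mulrBr subrXX mulrCA.
Qed.

Definition divdiff_poly n p y : {poly R[i]} :=
  \sum_(i < n.+1) p`_i *: \sum_(j < i) 'X^(i.-1 - j) * (y ^+ j)%:P.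

Lemma horner_divdiff_poly n p x y : (divdiff_poly n p y).[x] = divdiff n p x y.
Proof.
rewrite /divdiff_poly horner_sum; apply: eq_bigr => i _.
rewrite hornerZ horner_sum; congr (_ * _); apply: eq_bigr => j _.
by rewrite hornerM hornerXn hornerC.
Qed.

(** Both sides agree at all natural numbers, hence as polynomials. *)
Lemma divdiff_polyP n p y : (size p <= n.+1)%N -> p.[y] = 0 ->
  p = ('X - y%:P) * divdiff_poly n p y.
Proof.
move=> sp py; have /factor_theorem[q pq] : root p y by rewrite rootE py.
have [->|p0] := eqVneq p 0.
  rewrite /divdiff_poly big1 ?mulr0 // => i _; by rewrite coef0 scale0r.
have e (k : nat) : (p - ('X - y%:P) * divdiff_poly n p y).[k%:R] = 0.
  rewrite hornerD hornerN hornerM hornerXsubC horner_divdiff_poly -divdiffP //.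
  by rewrite py subr0 subrr.
apply/eqP; rewrite -subr_eq0; apply: contraT => q0.
set r := _ - _ in e q0.
have := max_poly_roots q0 (rs := [seq k%:R | k <- iota 0 (size r)]).
rewrite size_map size_iota ltnn => h; apply: h.
  by apply/allP => _ /mapP[k _ ->]; rewrite rootE e.
rewrite map_inj_uniq ?iota_uniq // => i j /eqP; rewrite eqr_nat.
by move/eqP.
Qed.

Section Family.
Variables (P : R -> {poly R[i]}) (n : nat).
Variable J : set R.
Hypothesis J_open : open J.
Hypothesis P_monic : forall t, J t -> P t \is monic.
Hypothesis P_size : forall t, J t -> size (P t) = n.+1.
Hypothesis P_circle : forall t z, J t -> (P t).[z] = 0 -> `|z| = 1.
Hypothesis P_simple : forall t z r, J t -> `|z| = 1 ->
  P t <> ('X - z%:P) * ('X - z%:P) * r.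
Hypothesis P_coef : forall t k, J t -> cderivable (fun u => (P u)`_k) t.

Lemma near_open t : J t -> \forall u \near t, J u.
Proof. by move=> Jt; exact: open_nbhs_nbhs. Qed.

(** On the diagonal the divided difference is the derivative. *)
Lemma divdiff_neq0 t z : J t -> (P t).[z] = 0 -> divdiff n (P t) z z != 0.
Proof.
move=> Jt Pz; have sP : (size (P t) <= n.+1)%N by rewrite P_size.
rewrite -horner_divdiff_poly; apply/eqP => /eqP/factor_theorem[r e].
apply: (@P_simple t z r Jt (P_circle Jt Pz)).
rewrite {1}(divdiff_polyP sP Pz) {1}e; ring.
Qed.

Lemma ccvg_divdiff (T : Type) (F : set_system T) (FF : Filter F) (p : T -> {poly R[i]})
    (x y : T -> R[i]) p0 x0 y0 :
  (forall k, ccvg F (fun s => (p s)`_k) p0`_k) -> ccvg F x x0 -> ccvg F y y0 ->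
  ccvg F (fun s => divdiff n (p s) (x s) (y s)) (divdiff n p0 x0 y0).
Proof.
move=> hp hx hy; apply: ccvg_sum => i; apply: ccvgM => //.
apply: ccvg_sum => j; apply: ccvgM; exact: ccvgX.
Qed.

Lemma cderivable_horner_cst t z : J t -> cderivable (fun u => (P u).[z]) t.
Proof.
move=> Jt.
apply: (@cderivable_near _ (fun u => \sum_(i < n.+1) (P u)`_i * z ^+ i)).
  apply: filterS (near_open Jt) => u Ju.
  by rewrite (horner_coef_wide _ (n := n.+1)) // P_size.
apply: cderivable_sum => i; apply: (cderivableM (P_coef _ Jt)).
exact: cderivable_cst.
Qed.

(** A small value of a monic polynomial with roots r_k, that is a small
    product of the |z - r_k|, forces a root near z. *)
Lemma near_root t z (d : R) : J t -> (P t).[z] = 0 -> 0 < d ->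
  \forall u \near t, exists2 x, `|x - z| < d%:C & (P u).[x] = 0.
Proof.
move=> Jt Pz d0.
have /ccvg_normP h := cderivable_ccvg (cderivable_horner_cst z Jt).
have dn : 0 < d ^+ n by rewrite exprn_gt0.
apply: filterS2 (near_open Jt) (h _ dn) => u Ju; rewrite Pz subr0 => lt.
have [rs e] := closed_field_poly_normal (P u).
move/monicP: (P_monic Ju) => lc; rewrite lc scale1r in e.
have srs : size rs = n.
  by have := P_size Ju; rewrite {1}e size_prod_XsubC => -[].
have [/hasP[x xrs xz]|/hasPn far] := boolP (has (fun x => `|x - z| < d%:C) rs).
  exists x => //; apply/eqP; rewrite -rootE e root_prod_XsubC //.
exfalso; move: lt; rewrite e horner_prod normr_prod => /lt_geF.
have : \prod_(x <- rs) (d%:C : R[i]) <= \prod_(x <- rs) `|('X - x%:P).[z]|.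
  rewrite !big_seq; apply: ler_prod => x xrs; rewrite lecR (ltW d0) /=.
  rewrite hornerXsubC distrC real_leNgt ?far ?normr_real //.
  by apply/complex_realP; exists d.
by rewrite big_const_seq count_predT srs iter_mulr_1 -rmorphXn => ->.
Qed.

(** Near (z0, z0, t0) the divided difference H does not vanish, so P_t has at most
    one zero near z0. The classical implicit function theorem would require
    continuously differentiable coefficients; instead,
    - P_u(zeta_t) = (zeta_u - zeta_t) H(u), where H is continuous and nonzero at t
    and the left side is differentiable. *)
Lemma simple_zero_function t0 z0 : J t0 -> (P t0).[z0] = 0 ->
  exists eps delta : R, [/\ 0 < eps, 0 < delta, I_ eps t0 `<=` J &
    exists zeta : R -> R[i], unique_zero_function P t0 z0 eps delta zeta].
Proof.
move=> Jt0 P0.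
pose F := filter_prod (filter_prod (cnbhs z0) (cnbhs z0)) (nbhs t0).
have hH : ccvg F (fun s => divdiff n (P s.2) s.1.1 s.1.2) (divdiff n (P t0) z0 z0).
  apply: ccvg_divdiff => [k||].
  - apply: (ccvg_comp (f := fun u => (P u)`_k) (g := snd)); first exact: cvg_snd.
    exact: cderivable_ccvg (P_coef k Jt0).
  - apply: (ccvg_comp (f := id) (g := fst \o fst)); last exact: ccvg_cnbhs.
    by apply: cvg_comp; [exact: cvg_fst|exact: cvg_fst].
  - apply: (ccvg_comp (f := id) (g := snd \o fst)); last exact: ccvg_cnbhs.
    by apply: cvg_comp; [exact: cvg_fst|exact: cvg_snd].
have [[A B] /= [[[A1 A2] /= [[d1 d10 h1] [d2 d20 h2]] hA] hB] hAB] :=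
  ccvg_neq0 hH (divdiff_neq0 Jt0 P0).
pose delta := Num.min d1 d2.
have delta0 : 0 < delta by rewrite lt_min d10.
have [eps /= eps0 heps] : nbhs_ball t0 [set u | [/\ B u, J u &
    exists2 x, `|x - z0| < delta%:C & (P u).[x] = 0]].
  apply/nbhs_ballP; apply: filterS3 hB (near_open Jt0) (near_root Jt0 P0 delta0) => u.
  by move=> *; split.
have hI t : I_ eps t0 t -> [/\ B t, J t &
    exists2 x, `|x - z0| < delta%:C & (P t).[x] = 0].
  by move=> It; apply: heps; rewrite /ball /= distrC.
have IJ : I_ eps t0 `<=` J by move=> t /hI[].
have uniq_root t x y : I_ eps t0 t -> `|x - z0| < delta%:C -> `|y - z0| < delta%:C ->
    (P t).[x] = 0 -> (P t).[y] = 0 -> x = y.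
  move=> It xd yd Px Py; have [Bt Jt _] := hI t It.
  have := divdiffP (n := n) (p := P t) x y; rewrite Px Py subrr P_size // => /(_ (ltnSn n))/esym/eqP.
  rewrite mulf_eq0 subr_eq0 => /orP[/eqP//|/eqP h0].
  suff : divdiff n (P t) x y != 0 by rewrite h0 eqxx.
  apply: (hAB ((x, y), t)); split => //=; apply: hA; split => /=.
    by apply: h1; apply: (lt_le_trans xd); rewrite lecR ge_min lexx.
  by apply: h2; apply: (lt_le_trans yd); rewrite lecR ge_min lexx orbT.
exists eps, delta; split => //.
pose zeta t := xget z0 [set x | `|x - z0| < delta%:C /\ (P t).[x] = 0].
have hz t : I_ eps t0 t -> `|zeta t - z0| < delta%:C /\ (P t).[zeta t] = 0.
  move=> It; have [_ _ [x xd Px]] := hI t It; rewrite /zeta.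
  by case: xgetP => [y _ []|/(_ x)] //; case; split.
have It0 : I_ eps t0 t0 by rewrite /I_ /= subrr normr0.
have openI t : I_ eps t0 t -> \forall u \near t, I_ eps t0 u.
  move=> It; have e0 : 0 < eps - `|t - t0| by rewrite subr_gt0.
  exists (eps - `|t - t0|) => // u /=; rewrite /I_ /= ltrBrDr => lt.
  apply: le_lt_trans lt; rewrite (_ : u - t0 = (u - t) + (t - t0)) ?[`|t - u|]distrC ?ler_normD //.
  by rewrite addrA subrK.
exists zeta; split; last first.
  move=> xi [_ hxi] t It; have [[xd _] _ Px] := hxi t It; have [zd Pz] := hz t It.
  exact: uniq_root It xd zd Px Pz.
have z00 : zeta t0 = z0.
  have [zd Pz] := hz t0 It0; apply: (uniq_root t0) => //.
  by rewrite subrr normr0 ltcR.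
split=> // t It; have [zd Pz] := hz t It; have Jt := IJ t It.
split; [split => //; exact: P_circle Jt Pz| |exact: Pz].
have zcont : ccvg (nbhs t) zeta (zeta t).
  apply/ccvg_normP => e e0.
  have r0 : 0 < delta%:C - `|zeta t - z0| by rewrite subr_gt0.
  pose r := complex.Re (delta%:C - `|zeta t - z0|).
  have rE : r%:C = delta%:C - `|zeta t - z0|.
    by rewrite /r RRe_real // gtr0_real.
  have rp : 0 < r by rewrite -ltcR rE.
  have m0 : 0 < Num.min e r by rewrite lt_min e0.
  apply: filterS2 (openI t It) (near_root Jt Pz m0) => u Iu [x xz Px].
  have [zud Pzu] := hz u Iu.
  have xz0 : `|x - z0| < delta%:C.
    rewrite (_ : x - z0 = (x - zeta t) + (zeta t - z0)); last by rewrite addrA subrK.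
    apply: (le_lt_trans (ler_normD _ _)); rewrite -ltrBrDr -rE.
    by apply: (lt_le_trans xz); rewrite lecR ge_min lexx orbT.
  rewrite -(uniq_root u x (zeta u) Iu xz0 zud Px Pzu).
  by apply: (lt_le_trans xz); rewrite lecR ge_min lexx.
pose H u := divdiff n (P u) (zeta u) (zeta t).
have Hc : ccvg (nbhs t) H (H t).
  apply: ccvg_divdiff => [k||]; [exact: cderivable_ccvg (P_coef k Jt)|exact: zcont|].
  exact: ccvg_cst.
have H0 : H t != 0 by exact: divdiff_neq0.
apply: (@cderivable_near _ (fun u => - (P u).[zeta t] * (H u)^-1 + zeta t)).
  apply: filterS2 (openI t It) (ccvg_neq0 Hc H0) => u Iu Hu0.
  have [_ Pzu] := hz u Iu; have Ju := IJ u Iu.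
  have := divdiffP (n := n) (p := P u) (zeta u) (zeta t).
  rewrite Pzu sub0r P_size // => /(_ (ltnSn n)) ->.
  by rewrite mulfK // subrK.
apply: cderivableD (cderivable_cst _ _).
apply: cderivable_mul_root.
- exact: cderivableN (cderivable_horner_cst _ Jt).
- by rewrite Pz oppr0.
- exact: ccvgV Hc H0.
Qed.

End Family.
End SimpleZero.

(** * The velocity of a zero *)

Section ZeroMotion.
Variables (R : realType) (theta0 : R).
Local Open Scope complex_scope.
Local Notation D := (args theta0).
Implicit Types (p q r : {poly R[i]}).

(** Synthetic division, from the top coefficient down. *)
Lemma cderivable_divided_coef (A B : R -> {poly R[i]}) (a : R -> R[i]) m t :
  (\near t, A t = ('X - (a t)%:P) * B t /\ (size (B t) <= m)%N) ->
  cderivable a t -> (forall k, cderivable (fun u => (A u)`_k) t) ->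
  forall k, cderivable (fun u => (B u)`_k) t.
Proof.
move=> h ha hA.
suff H d k : (m <= k + d)%N -> cderivable (fun u => (B u)`_k) t.
  by move=> k; apply: (H m); exact: leq_addl.
elim: d k => [|d IH] k mk.
  apply: (@cderivable_near _ (fun=> 0)); last exact: cderivable_cst.
  apply: filterS h => u [_ sB]; rewrite nth_default //.
  by rewrite addn0 in mk; exact: leq_trans sB mk.
apply: (@cderivable_near _ (fun u => (A u)`_k.+1 + a u * (B u)`_k.+1)).
  apply: filterS h => u [-> _].
  by rewrite mulrBl coefB coefXM /= coefCM subrK.
apply: (cderivableD (hA _)); apply: (cderivableM ha).
by apply: IH; rewrite addSnnS.
Qed.

(** With q = (z - e0) r, orthogonality of (z - a) q to z r says that
    <q, r> = a <q, z r>; expand the second argument of <q, q>. *)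
Lemma velocity_denominator (nu : {finite_measure set (measurableTypeR R) -> \bar R})
    r (a e0 : R[i]) : `|e0| = 1 ->
  inner nu D (('X - a%:P) * (('X - e0%:P) * r)) ('X * r) = 0 ->
  (1 - a / e0) * inner nu D (('X - e0%:P) * r) ('X * r)
  = inner nu D (('X - e0%:P) * r) (('X - e0%:P) * r).
Proof.
move=> e1; set q := ('X - e0%:P) * r => h.
have qE : q = 'X * r + (- e0) *: r by rewrite /q mulrBl mul_polyC scaleNr.
have hr : inner nu D q r = a * inner nu D q ('X * r).
  move: h; rewrite mulrBl mul_polyC -scaleNr innerDl innerZl mulNr.
  rewrite (@eq_inner_circle _ _ _ ('X * q) ('X * r) q r 1) ?mul1r => [/subr0_eq//|].
  move=> x x1; rewrite !hornerM hornerX (rmorphM conjc) /= mul1r.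
  by rewrite mulrACA norm1_mulcJ // mul1r.
transitivity (inner nu D q ('X * r + (- e0) *: r)); last by rewrite -qE.
rewrite innerDr innerZr hr (rmorphN conjc) /= norm1_conjc //.
move: (inner _ _ _ _) => B; ring.
Qed.

Variables (J : set R) (N : nat).
Variable mu : {measure set (measurableTypeR R) -> \bar R}.
Variables (w : R -> R -> \bar R) (gamma omega : 'I_N.+1 -> R -> R).
Variable nu : R -> {finite_measure set (measurableTypeR R) -> \bar R}.
Variable alpha : R -> R.
Variable E : set (measurableTypeR R).
Hypothesis J_open : open J.
Hypothesis gamma_diff : forall j t, J t -> derivable (gamma j) t 1.
Hypothesis omega_diff : forall j t, J t -> derivable (omega j) t 1.
Hypothesis regE : regular_set J theta0 mu w gamma omega nu alpha E.
Local Notation cdt := (cdt_integral mu w gamma omega E).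

Lemma cderive_moment p q t : J t ->
  is_cderive (fun u => inner (nu u) D p q) t
    (cdt (fun x => p.[expi x] * conjc q.[expi x]) t).
Proof. by move=> Jt; exact: (is_cderive_inner J_open gamma_diff omega_diff regE p q Jt). Qed.

(** Subtracting the relations inner_u(P_u, z R_t) = 0 and
    inner_t(P_t, z R_u) = 0 leaves the increment of the zero on one side and
    the increment of the measure on the other; no derivative of another zero
    appears. *)
Lemma velocity_equation (P Q : R -> {poly R[i]}) (zeta : R -> R[i]) (e0 dz : R[i]) n t :
  J t -> `|e0| = 1 -> is_cderive zeta t dz ->
  (forall k, cderivable (fun u => (P u)`_k) t) ->
  (\near t, [/\ P t = ('X - (zeta t)%:P) * (('X - e0%:P) * Q t), `|zeta t| = 1,
     size (P t) = n.+1, (size (Q t) < n)%N & paraorth theta0 (nu t) n (P t)]) ->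
  cdt (fun x => (P t).[expi x] * conjc ('X * Q t).[expi x]) t
  = dz * inner (nu t) D (('X - e0%:P) * Q t) ('X * Q t).
Proof.
move=> Jt e1 hz hP near_t.
have [Pt zt1 sPt sQt ot] := nbhs_singleton near_t.
pose V u := ('X - e0%:P) * Q u.
have sXa (a : R[i]) : size ('X - a%:P) = 2%N by rewrite size_XsubC.
have sV u : (size (Q u) < n)%N -> (size (V u) <= n)%N.
  move=> sQ; apply: (leq_trans (size_polyMleq _ _)); rewrite sXa /=.
  by case: (size _) sQ.
have hV k : cderivable (fun u => (V u)`_k) t.
  apply: (@cderivable_divided_coef P V zeta n); last exact: hP.
    by apply: filterS near_t => u [Pu _ _ sQ _]; split; [exact: Pu|exact: sV].
  by apply/cderivableP; exists dz.
pose XQ := 'X * Q t.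
pose G u := \sum_(i < n.+1) (P u)`_i * (inner (nu u) D 'X^i XQ - inner (nu t) D 'X^i XQ).
have dG : is_cderive G t (cdt (fun x => (P t).[expi x] * conjc XQ.[expi x]) t).
  have hi (i : nat) : exists d, is_cderive (fun u => (P u)`_i) t d by apply/cderivableP.
  have dm i := cderive_moment 'X^i XQ Jt.
  have : is_cderive G t (\sum_(i < n.+1) (P t)`_i *
      cdt (fun x => ('X^i).[expi x] * conjc XQ.[expi x]) t).
    apply: is_cderive_sum => i; have [d hd] := hi i.
    have hB := is_cderiveD (dm i) (is_cderive_cst (- inner (nu t) D 'X^i XQ) t).
    apply: is_cderive_val (is_cderiveM hd hB).
    by rewrite /= subrr mulr0 add0r addr0.
  apply: is_cderive_val; apply: is_cderive_unique (cderive_moment (P t) XQ Jt).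
  have sP : (size (P t) <= n.+1)%N by rewrite sPt.
  under eq_fun do rewrite (inner_coef _ _ _ sP).
  apply: is_cderive_sum => i.
  apply: is_cderive_val (is_cderiveM (is_cderive_cst (P t)`_i t) (dm i)).
  by rewrite mul0r add0r.
pose F u := \sum_(i < n) (V u)`_i * inner (nu t) D 'X^i XQ.
have FE u : (size (Q u) < n)%N -> F u = inner (nu t) D (V u) XQ.
  by move=> sQ; rewrite /F -(inner_coef _ _ _ (sV u sQ)).
have [dF hF] : exists d, is_cderive F t d.
  apply/cderivableP; apply: cderivable_sum => i.
  exact: (cderivableM (hV i) (cderivable_cst _ _)).
have dR := is_cderiveM (is_cderiveD hz (is_cderive_cst (- zeta t) t)) hF.
rewrite -FE //; apply: is_cderive_unique dG _.
have : is_cderive (fun u => (zeta u + - zeta t) * F u) t (dz * F t).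
  by apply: is_cderive_val dR; rewrite subrr mul0r !addr0.
apply: is_cderive_near; apply: filterS near_t => u [Pu zu1 sPu sQu ou].
have sP : (size (P u) <= n.+1)%N by rewrite sPu.
rewrite /G; under [RHS]eq_bigr do rewrite mulrBr.
rewrite sumrB -!(inner_coef _ _ _ sP) (paraorth_mulX ou) // sub0r FE //.
have -> : P u = ('X - (zeta t)%:P) * V u + (- (zeta u - zeta t)) *: V u.
  rewrite Pu -/(V u) scaleNr -mul_polyC polyCB; ring.
rewrite innerDl innerZl.
have -> : inner (nu t) D (('X - (zeta t)%:P) * V u) XQ = 0.
  have ca : zeta t * e0 != 0 by rewrite mulf_neq0 // norm1_neq0.
  rewrite (@eq_inner_circle _ _ _ _ _ ('X * Q u) (P t) (zeta t * e0)).
    by rewrite inner_conj (paraorth_mulX ot) // rmorph0 mulr0.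
  move=> x x1; rewrite Pt /V /XQ !hornerM !hornerXsubC !hornerX.
  rewrite !(rmorphM conjc) !(rmorphB conjc) /=.
  rewrite (norm1_conjc x1) (norm1_conjc zt1) (norm1_conjc e1).
  have x0 := norm1_neq0 x1; have z0 := norm1_neq0 zt1; have e00 := norm1_neq0 e1.
  move: (conjc (Q t).[x]) (Q u).[x] => c v.
  by field; rewrite x0 z0 e00.
by rewrite add0r mulNr opprK.
Qed.

End ZeroMotion.

(** * The kernel |P|^2 s *)

Section Kernel.
Variables (R : realType) (theta0 : R).
Local Open Scope complex_scope.
Local Notation D := (args theta0).

(** The squared distance of two points of the circle, from their arguments. *)
Definition sqdist (x y : R) : R := 4 * sin ((x - y) / 2) ^+ 2.

Let I : R[i] := 0 +i* 1.

Let II : I * I = -1.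
Proof. by apply: complex_ext; rewrite !ReImE /=; ring. Qed.

Let natrC k : (k%:R : R)%:C = k%:R :> R[i].
Proof. exact: (rmorph_nat (real_complex R)). Qed.

Lemma sin_expi (x : R) : 2%:R * (sin x)%:C = - I * (expi x - (expi x)^-1).
Proof.
rewrite -expi_conj; apply: complex_ext; rewrite !ReImE /=; ring.
Qed.

Lemma sin_half_expi (x y : R) :
  2%:R * (sin ((x - y) / 2))%:C
  = - I * (expi (x / 2) / expi (y / 2) - expi (y / 2) / expi (x / 2)).
Proof.
rewrite sin_expi mulrBl expiD expiN; congr (_ * (_ - _)).
by rewrite invfM invrK mulrC.
Qed.

Lemma expi_half (x : R) : expi x = expi (x / 2) * expi (x / 2).
Proof. by rewrite -expiD -splitr. Qed.

Lemma chord_sqr (x y : R) :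
  (expi x - expi y) * conjc (expi x - expi y) = (sqdist y x)%:C.
Proof.
have -> : (sqdist y x)%:C = (2%:R * (sin ((y - x) / 2))%:C) ^+ 2.
  by rewrite /sqdist rmorphM rmorphXn /= natrC (natrX _ 2 2) -exprMn.
rewrite sin_half_expi conjcB !expi_conj (expi_half x) (expi_half y).
have := expi_neq0 (x / 2); have := expi_neq0 (y / 2).
move: (expi (x / 2)) (expi (y / 2)) => p q q0 p0.
transitivity (- (I * I) * - (q / p - p / q) ^+ 2); last by ring.
by rewrite II; field; rewrite p0 q0.
Qed.

Variables (n : nat) (phi : nat -> R -> R) (t : R).

(** The value of |P|^2 at e^(i theta). *)
Definition absP2 (theta : R) : R := \prod_(1 <= k < n.+1) sqdist (phi k t) theta.

(** The product |P|^2 s written without denominators, hence smooth across the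
    poles of s. *)
Definition pkernel (theta : R) : R :=
  8 * sin ((phi n t - theta0) / 2) * sin ((phi n t - theta) / 2)
    * sin ((theta0 - theta) / 2) * \prod_(1 <= k < n.-1) sqdist (phi k t) theta.

Definition rest_poly : {poly R[i]} := \prod_(1 <= k < n.-1) ('X - (expi (phi k t))%:P).

Hypotheses (n_gt1 : (1 < n)%N) (phi0 : phi n.-1 t = theta0).

Lemma pkernelE (theta : R) : pkernel theta = absP2 theta * s_ theta0 n phi theta t.
Proof.
rewrite /pkernel /absP2 /s_; case: n n_gt1 phi0 => [|[|m]] //= _ p0.
rewrite (@big_nat_recr _ _ _ m.+2) // (@big_nat_recr _ _ _ m.+1) //= p0 /sqdist.
set A := \big[_/_]_(_ <= _ < _) _.
set a := sin ((_ - theta) / 2); set c := sin ((theta0 - theta) / 2).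
have [->|a0] := eqVneq a 0; first by rewrite !(mulr0, mul0r, expr0n).
have [->|c0] := eqVneq c 0; first by rewrite !(mulr0, mul0r, expr0n).
by field; rewrite a0 c0.
Qed.

Lemma rest_polyE : \prod_(1 <= k < n.+1) ('X - (expi (phi k t))%:P)
  = ('X - (expi (phi n t))%:P) * (('X - (expi theta0)%:P) * rest_poly).
Proof.
rewrite /rest_poly; case: n n_gt1 phi0 => [|[|m]] //= _ p0.
by rewrite (@big_nat_recr _ _ _ m.+2) // (@big_nat_recr _ _ _ m.+1) //= p0; ring.
Qed.

Lemma size_rest_poly : size rest_poly = n.-1.
Proof.
rewrite /rest_poly size_prod_XsubC size_iota.
by case: n n_gt1 => [|[|m]] //= _; rewrite subn1.
Qed.

(** Up to a constant factor the kernel is P conj(z R), where R collects the zeros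
    other than the fixed and the moving one: it is the integrand of an
    orthogonality relation. *)
Lemma pkernel_poly (theta : R) :
  I * (expi (phi n t) - expi theta0) / (expi (phi n t) * expi theta0)
  * ((\prod_(1 <= k < n.+1) ('X - (expi (phi k t))%:P)).[expi theta]
     * conjc ('X * rest_poly).[expi theta]) = (pkernel theta)%:C.
Proof.
rewrite rest_polyE !hornerM !hornerXsubC hornerX conjcM.
have hr : rest_poly.[expi theta] * conjc rest_poly.[expi theta]
    = (\prod_(1 <= k < n.-1) sqdist (phi k t) theta)%:C.
  rewrite /rest_poly horner_prod rmorph_prod /= -big_split rmorph_prod /=.
  by apply: eq_bigr => k _; rewrite hornerXsubC chord_sqr.
rewrite expi_conj /pkernel !rmorphM /= -hr.
rewrite natrC.
set X := rest_poly.[_]; set Y := conjc X.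
transitivity ((2%:R * (sin ((phi n t - theta0) / 2))%:C)
   * (2%:R * (sin ((phi n t - theta) / 2))%:C)
   * (2%:R * (sin ((theta0 - theta) / 2))%:C) * (X * Y)); last by ring.
rewrite !sin_half_expi (expi_half (phi n t)) (expi_half theta0) (expi_half theta).
have := expi_neq0 (phi n t / 2); have := expi_neq0 (theta0 / 2); have := expi_neq0 (theta / 2).
move: (expi (phi n t / 2)) (expi (theta0 / 2)) (expi (theta / 2)) X Y => p o q X Y q0 o0 p0.
transitivity (- (I * I) * I * (p * p - o * o) / (p * p * (o * o))
   * ((q * q - p * p) * ((q * q - o * o) * X) * ((q * q)^-1 * Y))).
  by rewrite II opprK mul1r.
by field; rewrite p0 o0 q0.
Qed.

Lemma bdiff_pkernel : bdiff pkernel.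
Proof.
pose f theta := I * (expi (phi n t) - expi theta0) / (expi (phi n t) * expi theta0)
  * ((\prod_(1 <= k < n.+1) ('X - (expi (phi k t))%:P)).[expi theta]
     * conjc ('X * rest_poly).[expi theta]).
have [h _] : cbdiff f by apply: (cbdiffM (cbdiff_cst _)); exact: cbdiff_inner.
rewrite (_ : pkernel = fun x => complex.Re (f x)) //.
by apply/funext => x; rewrite /f pkernel_poly.
Qed.

Lemma absP2_poly (theta : R) (P : {poly R[i]}) :
  P = \prod_(1 <= k < n.+1) ('X - (expi (phi k t))%:P) ->
  P.[expi theta] <> 0 -> forall k, (1 <= k <= n)%N -> sin ((phi k t - theta) / 2) != 0.
Proof.
move=> -> h k kn; apply/eqP => sk; apply: h; rewrite horner_prod.
apply/eqP; rewrite prodf_seq_eq0; apply/hasP; exists k; first by rewrite mem_index_iota ltnS.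
rewrite hornerXsubC /=; have := chord_sqr theta (phi k t).
rewrite /sqdist sk expr0n mulr0 => /eqP; rewrite mulf_eq0 conjc_eq0 orbb.
by [].
Qed.

Lemma absP2_gt0 (theta : R) :
  (forall k, (1 <= k <= n)%N -> sin ((phi k t - theta) / 2) != 0) -> 0 < absP2 theta.
Proof.
move=> h; rewrite /absP2 big_seq_cond; apply: prodr_gt0 => k /andP[].
rewrite mem_index_iota ltnS => kn _; rewrite mulr_gt0 // exprn_even_gt0 //=.
by rewrite h.
Qed.

Lemma absP2_ge0 (theta : R) : 0 <= absP2 theta.
Proof. by apply: prodr_ge0 => k _; rewrite mulr_ge0 // sqr_ge0. Qed.

Lemma is_derive_sin_half (x y : R) : sin ((x - y) / 2) != 0 ->
  is_derive y 1 (fun u => sin ((x - u) / 2))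
    (sin ((x - y) / 2) * - (2^-1 * cot ((x - y) / 2))).
Proof.
move=> s0.
have d1 : is_derive y 1 (fun u : R => (x - u) / 2) (- 2^-1).
  have := is_deriveM (is_deriveB (is_derive_cst x y 1) (is_derive_id y 1))
    (is_derive_cst (2^-1 : R) y 1).
  by apply: is_derive_val; rewrite /GRing.scale /= mulr0 add0r; ring.
apply: is_derive_val (is_derive1_comp (is_derive_sin _) d1).
by rewrite /cot; field.
Qed.

(** Derivatives are recorded as value times logarithmic derivative, so that
    products add up. *)
Lemma is_derive_logM (f g : R -> R) (y l m : R) :
  is_derive y 1 f (f y * l) -> is_derive y 1 g (g y * m) ->
  is_derive y 1 (fun u => f u * g u) (f y * g y * (l + m)).
Proof.
move=> hf hg; apply: is_derive_val (is_deriveM hf hg).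
by rewrite /GRing.scale /=; ring.
Qed.

Lemma is_derive_log_cst (c y : R) : is_derive y 1 (fun=> c : R) (c * 0).
Proof. by rewrite mulr0; exact: is_derive_cst. Qed.

Lemma is_derive_log_prod (f : nat -> R -> R) (l : nat -> R) (a b : nat) (y : R) :
  (forall k, (a <= k < b)%N -> is_derive y 1 (f k) (f k y * l k)) ->
  is_derive y 1 (fun u => \prod_(a <= k < b) f k u)
    ((\prod_(a <= k < b) f k y) * \sum_(a <= k < b) l k).
Proof.
elim: b => [|b IH] h.
  under eq_fun do rewrite big_geq //; rewrite !big_geq //.
  exact: is_derive_log_cst.
have [ab|ba] := leqP a b; last first.
  under eq_fun do rewrite big_geq //; rewrite !big_geq //.
  exact: is_derive_log_cst.
under eq_fun do rewrite big_nat_recr //=; rewrite !big_nat_recr //=.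
apply: is_derive_logM; last by apply: h; rewrite ab ltnSn.
by apply: IH => k /andP[ak kb]; apply: h; rewrite ak ltnS ltnW.
Qed.

(** Every zero enters the kernel squared, except the fixed and the moving one,
    which enter once: whence the halved terms of S. *)
Lemma is_derive_pkernel (y : R) :
  (forall k, (1 <= k <= n)%N -> sin ((phi k t - y) / 2) != 0) ->
  is_derive y 1 pkernel (- (pkernel y * S_ n phi y t)).
Proof.
move=> h.
have [n1 n2 n3] : [/\ (1 <= n <= n)%N, (1 <= n.-1 <= n)%N & n = n.-1.+1].
  by case: n n_gt1 => [|[|m]] //= _; rewrite leqnn leqnSn.
have dn := is_derive_sin_half (h n n1).
have d0 := is_derive_sin_half (h _ n2); rewrite phi0 in d0.
have dk k : (1 <= k < n.-1)%N -> is_derive y 1 (sqdist (phi k t))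
    (sqdist (phi k t) y * - cot ((phi k t - y) / 2)).
  move=> /andP[k1 kn]; have k2 : (1 <= k <= n)%N.
    by rewrite k1 (leq_trans (ltnW kn)) // leq_pred.
  have hk := is_derive_sin_half (h k k2).
  have := is_derive_logM (is_derive_log_cst 4 y) (is_derive_logM hk hk).
  apply: is_derive_val; by rewrite /sqdist; field.
have := is_derive_logM (is_derive_logM (is_derive_logM (is_derive_log_cst
   (8 * sin ((phi n t - theta0) / 2)) y) dn) d0) (is_derive_log_prod dk).
apply: is_derive_val; rewrite -[LHS]/(pkernel y * _) -[RHS]mulrN; congr (_ * _).
rewrite /S_; move: n2 n3 phi0; case: n n_gt1 => [|[|m]] //= _ _ _ p0.
rewrite (@big_nat_recr _ _ _ m.+2) // (@big_nat_recr _ _ _ m.+1) //= p0 !eqxx.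
have -> : (m.+1 == m.+2) = false by rewrite ltn_eqF.
have -> : (m.+2 == m.+1) = false by rewrite gtn_eqF.
rewrite (_ : \sum_(1 <= k < m.+1) _ = - \sum_(1 <= k < m.+1) cot ((phi k t - y) / 2)).
  rewrite [X in _ = - (X + _ + _)](_ : _ = \sum_(1 <= k < m.+1) cot ((phi k t - y) / 2)).
    by rewrite !(addr0, add0r) -[1 + 1]/(2%:R); ring.
  apply: eq_big_nat => k /andP[_ km].
  by rewrite (ltn_eqF km) (ltn_eqF (leqW km)) !addr0 invr1 mul1r.
by rewrite sumrN.
Qed.

End Kernel.

(** * Arguments of moving points *)

Section Arguments.
Variables (R : realType) (theta0 : R).
Local Open Scope complex_scope.
Local Notation D := (args theta0).

Lemma sin_half_neq0 (x y : R) : D x -> D y -> x <> y -> sin ((x - y) / 2) != 0.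
Proof.
move=> Dx Dy xy; apply/eqP => s0; apply: xy.
apply: (@expi_inj R theta0); rewrite ?inE //.
have := chord_sqr y x; rewrite /sqdist s0 expr0n mulr0.
by move/eqP; rewrite mulf_eq0 conjc_eq0 orbb subr_eq0 => /eqP.
Qed.

Lemma sin_half_gt0 (x y : R) : 0 < x - y < 2 * pi -> 0 < sin ((x - y) / 2).
Proof.
move=> /andP[h1 h2]; apply: sin_gt0_pi; apply/andP; split; first by rewrite divr_gt0.
by rewrite ltr_pdivrMr // mulrC.
Qed.

Lemma sin_half_lt0 (x y : R) : 0 < y - x < 2 * pi -> sin ((x - y) / 2) < 0.
Proof.
move=> h; rewrite -[x - y]opprB mulNr sinN oppr_lt0; exact: sin_half_gt0.
Qed.

(** The factor s changes sign exactly where theta crosses the moving zero. *)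
Lemma s_weight_sign (n : nat) (phi : nat -> R -> R) (t theta : R) (f : R -> R) :
  phi n t \in `]theta0, theta0 + 2 * pi[ ->
  theta \in `]theta0, theta0 + 2 * pi[ -> theta <> phi n t ->
  ((theta < phi n t -> f theta < f (phi n t)) ->
   (phi n t < theta -> f (phi n t) < f theta) ->
   0 < s_ theta0 n phi theta t * (f theta - f (phi n t))) /\
  ((theta < phi n t -> f theta <= f (phi n t)) ->
   (phi n t < theta -> f (phi n t) <= f theta) ->
   0 <= s_ theta0 n phi theta t * (f theta - f (phi n t))).
Proof.
rewrite !in_itv /= /s_; set p := phi n t => /andP[p1 p2] /andP[h1 h2] ne.
have sp : 0 < sin ((p - theta0) / 2) by apply: sin_half_gt0; lra.
have st : sin ((theta0 - theta) / 2) < 0 by apply: sin_half_lt0; lra.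
have [lt|gt|//] := ltgtP theta p.
  have sn : 0 < sin ((p - theta) / 2) by apply: sin_half_gt0; lra.
  have s0 : sin ((p - theta0) / 2) /
      (2 * sin ((p - theta) / 2) * sin ((theta0 - theta) / 2)) < 0.
    by rewrite pmulr_rlt0 // invr_lt0 pmulr_rlt0 // mulr_gt0.
  by split => [/(_ isT) hf _|/(_ isT) hf _]; [rewrite nmulr_rgt0|rewrite nmulr_rge0];
    rewrite // ?subr_lt0 ?subr_le0.
have sn : sin ((p - theta) / 2) < 0 by apply: sin_half_lt0; lra.
have s0 : 0 < sin ((p - theta0) / 2) /
    (2 * sin ((p - theta) / 2) * sin ((theta0 - theta) / 2)).
  by rewrite divr_gt0 // nmulr_rgt0 // pmulr_rlt0.
by split => [_ /(_ isT) hf|_ /(_ isT) hf]; [rewrite pmulr_rgt0|rewrite pmulr_rge0];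
  rewrite // ?subr_gt0 ?subr_ge0.
Qed.

(** An argument in (0, 2 pi) is a smooth function of its sine and cosine, since
    sin x / (1 - cos x) is the cotangent of x / 2. *)
Lemma arg_atan (x : R) : 0 < x < 2 * pi -> x = pi - 2 * atan (sin x / (1 - cos x)).
Proof.
move=> /andP[x0 x2]; pose y := x / 2.
have xy : x = y *+ 2 by rewrite /y -mulr_natr -mulrA mulVf ?mulr1 // pnatr_eq0.
have sy : 0 < sin y by apply: sin_gt0_pi; rewrite /y; apply/andP; split; lra.
have e : sin x / (1 - cos x) = tan (pi / 2 - y).
  rewrite /tan -[pi / 2 - y]opprB sinN cosN cosBpihalf sinBpihalf opprK.
  rewrite xy sin_mulr2n cos_mulr2n cos2sin2.
  have -> : 1 - ((1 - sin y ^+ 2) *+ 2 - 1) = sin y * sin y *+ 2 by ring.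
  rewrite -mulrnAl -[(sin y * sin y) *+ 2]mulrnAl.
  by field; rewrite gt_eqF.
rewrite e tanK; first by rewrite /y; field.
by rewrite in_itv /= /y; apply/andP; split; lra.
Qed.

Lemma derivable_arg (phi : R -> R) (zeta : R -> R[i]) (t : R) :
  (\near t, (phi t \in `]theta0, theta0 + 2 * pi[) /\ zeta t = expi (phi t)) ->
  cderivable zeta t -> derivable phi t 1.
Proof.
move=> h hz; pose g u := zeta u * conjc (expi theta0).
have hg : cderivable g t by exact: (cderivableM hz (cderivable_cst _ _)).
have gE u : zeta u = expi (phi u) -> g u = expi (phi u - theta0).
  by move=> zu; rewrite /g zu expi_conj expiD expiN.
have [It zt] := nbhs_singleton h.
pose c u := complex.Im (g u) * (1 - complex.Re (g u))^-1.
have c0 : 1 - complex.Re (g t) != 0.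
  rewrite gE //= -[phi t - theta0](divfK (x := 2)) ?pnatr_eq0 // mulr_natr cos_mulr2n cos2sin2.
  have -> (s : R) : 1 - ((1 - s) *+ 2 - 1) = s *+ 2 by ring.
  rewrite mulrn_eq0 /= sqrf_eq0 gt_eqF // sin_half_gt0 //.
  by move: It; rewrite in_itv /= => /andP[? ?]; apply/andP; split; lra.
case: hg => dRe dIm.
have dc : derivable c t 1.
  apply: (derivableM dIm); apply: (@derivableV _ _ (fun u => 1 - complex.Re (g u))).
    exact: c0.
  exact: (derivableB (derivable_cst _ _ _) dRe).
have da : derivable (fun u => theta0 + (pi - 2 * atan (c u))) t 1.
  have := is_derive1_comp (is_derive1_atan (c t)) (derivable_is_derive1 dc).
  move=> [dac _].
  apply: (derivableD (derivable_cst _ _ _)); apply: (derivableB (derivable_cst _ _ _)).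
  exact: (derivableM (derivable_cst _ _ _) dac).
apply: near_eq_derivable da; apply: filterS h => u [Iu zu].
rewrite /c gE //= -arg_atan; first by rewrite addrC subrK.
by move: Iu; rewrite in_itv /= => /andP[? ?]; apply/andP; split; lra.
Qed.

Lemma is_cderive_expi (phi : R -> R) (d t : R) : is_derive t 1 phi d ->
  is_cderive (fun u => expi (phi u)) t ((0 +i* 1) * d%:C * expi (phi t)).
Proof.
move=> h; split; rewrite !ReImE /=.
  apply: is_derive_val (is_derive1_comp (is_derive_cos _) h); ring.
apply: is_derive_val (is_derive1_comp (is_derive_sin _) h); ring.
Qed.

End Arguments.

Section DtWeight.
Variables (R : realType) (J : set R) (theta0 : R) (N : nat).
Variable mu : {measure set (measurableTypeR R) -> \bar R}.
Variables (w : R -> R -> \bar R) (gamma omega : 'I_N.+1 -> R -> R).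
Variable nu : R -> {finite_measure set (measurableTypeR R) -> \bar R}.
Variable alpha : R -> R.
Variable E : set (measurableTypeR R).
Hypothesis J_open : open J.
Hypothesis regE : regular_set J theta0 mu w gamma omega nu alpha E.

Lemma open_interval (t : R) : J t -> exists2 e : R, 0 < e &
  forall u, u \in `]t - e, t + e[ -> J u.
Proof.
move=> Jt; have [e /= e0 eJ] : nbhs_ball t J by apply/nbhs_ballP; exact: open_nbhs_nbhs.
exists e => // u; rewrite in_itv /= => /andP[h1 h2]; apply: eJ.
by rewrite /ball /= ltr_norml; apply/andP; split; lra.
Qed.

(** The derivative is measurable as a limit of difference quotients. *)
Lemma integrable_dt_weight (t : R) : J t ->
  mu.-integrable E (EFin \o (fun theta => dt_weight w theta t)).
Proof.
move=> Jt; have [[mE ED] ialpha hE iw _] := regE.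
have [e e0 eJ] := open_interval Jt.
(* increments tending to 0 that never leave J *)
pose h (k : nat) : R := e / 2 * k.+1%:R^-1.
have h0 k : 0 < h k by rewrite mulr_gt0 ?invr_gt0 // divr_gt0.
have hJ k : J (h k + t).
  apply: eJ; rewrite in_itv /=; apply/andP; split.
    by have := h0 k; lra.
  suff : h k <= e / 2 by lra.
  by rewrite /h ler_piMr ?divr_ge0 ?(ltW e0) // invf_le1 ?ler1n.
have hc : h k @[k --> \oo] --> (0 : R).
  rewrite -[X in _ --> X](mulr0 (e / 2)); apply: cvgM; first exact: cvg_cst.
  exact: cvg_harmonic.
pose q k theta := (h k)^-1 * (fine (w theta (h k + t)) - fine (w theta t)).
have mw u : J u -> measurable_fun E (fun theta => fine (w theta u)).
  by move=> Ju; have /integrableP[/measurable_EFinP] := iw u Ju.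
have mdt : measurable_fun E (fun theta => dt_weight w theta t).
  apply: (@measurable_fun_cvg _ _ _ E q).
    move=> k; apply: measurable_funM => //; apply: measurable_funB; exact: mw.
  move=> x Ex; have [_ d _] := hE x t Ex Jt.
  have /cvgr_dnbhsP := d => /(_ h) hh.
  have := hh (conj (fun k => lt0r_neq0 (h0 k)) hc).
  rewrite /dt_weight derive1E /derive.
  by under eq_fun do rewrite /= [_ *: 1]mulr1.
apply: (@le_integrable _ _ _ mu E mE _ (EFin \o alpha)) => //.
  exact/measurable_EFinP.
move=> x Ex; rewrite /= lee_fin; have [_ _ b] := hE x t Ex Jt.
by apply: (le_trans b); exact: ler_norm.
Qed.

(** The weight is nonnegative, so its derivative vanishes where it does. *)
Lemma dt_weightE (theta t : R) : E theta -> J t ->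
  dt_weight w theta t = fine (w theta t) * logdt_weight w theta t.
Proof.
move=> Ex Jt; have [_ _ hE _ _] := regE; rewrite /logdt_weight.
have [w0|w0] := eqVneq (fine (w theta t)) 0; last by rewrite mulrA divff ?mul1r.
rewrite w0 mul0r; have [e e0 eJ] := open_interval Jt.
have := @derive1_at_min R (fun u => fine (w theta u)) (t - e) (t + e) t.
rewrite /dt_weight derive1E => h.
have [] : is_derive t 1 (fun u => fine (w theta u)) 0; last by [].
apply: h.
- by lra.
- by move=> u /eJ Ju; have [] := hE theta u Ex Ju.
- by rewrite in_itv /=; apply/andP; split; lra.
- by move=> u /eJ Ju; rewrite w0; have [] := hE theta u Ex Ju.
Qed.

End DtWeight.

(** * The velocity formula *)

Section Velocity.
Variables (R : realType) (J : set R) (theta0 : R) (N : nat).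
Variable mu : {measure set (measurableTypeR R) -> \bar R}.
Variables (w : R -> R -> \bar R) (gamma omega : 'I_N.+1 -> R -> R).
Variable nu : R -> {finite_measure set (measurableTypeR R) -> \bar R}.
Variable alpha : R -> R.
Variable E : set (measurableTypeR R).
Local Open Scope complex_scope.
Local Notation D := (args theta0).
Local Notation mD := (@measurable_args R theta0).
Hypothesis J_open : open J.
Hypothesis gamma_diff : forall j t, J t -> derivable (gamma j) t 1.
Hypothesis omega_diff : forall j t, J t -> derivable (omega j) t 1.
Hypothesis regE : regular_set J theta0 mu w gamma omega nu alpha E.
Hypothesis nu_inf : forall t, J t -> ~ finite_point_masses (nu t) (args theta0).

Variables (I : set R) (n : nat) (P : R -> {poly R[i]}) (zeta : R -> R[i])
  (phi : nat -> R -> R).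
Hypothesis I_open : open I.
Hypothesis IJ : I `<=` J.
Hypothesis n_gt1 : (1 < n)%N.
Hypothesis P_para : forall t, I t -> paraorth theta0 (nu t) n (P t).
Hypothesis P_prod : forall t, I t ->
  P t = \prod_(1 <= k < n.+1) ('X - (expi (phi k t))%:P).
Hypothesis phi_prev : forall t, I t -> phi n.-1 t = theta0.
Hypothesis phi_arc : forall t, I t -> phi n t \in `]theta0, theta0 + 2 * pi[.
Hypothesis zetaE : forall t, I t -> zeta t = expi (phi n t).
Hypothesis zeta_diff : forall t, I t -> cderivable zeta t.
Hypothesis mass_nonzero : forall t j, I t -> (P t).[expi (omega j t)] <> 0.

Lemma derivable_phi t : I t -> derivable (phi n) t 1.
Proof.
move=> It; apply: (@derivable_arg _ theta0 _ zeta); last exact: zeta_diff.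
by apply: filterS (near_open I_open It) => u Iu; split; [exact: phi_arc|exact: zetaE].
Qed.

Lemma P_coef_diff t k : I t -> cderivable (fun u => (P u)`_k) t.
Proof.
move=> It; have Jt := IJ It.
have n0 : (0 < n)%N by exact: ltnW.
(* the fixed zero provides the equation that determines P *)
apply: (@cderivable_paraorth_coef _ theta0 nu P n (expi theta0) (fun=> 0)) => //.
- by rewrite norm_expi.
- move=> i j; apply/cderivableP; eexists.
  exact: (cderive_moment J_open gamma_diff omega_diff regE 'X^i 'X^j Jt).
apply: filterS (near_open I_open It) => u Iu; split.
- exact: nu_inf (IJ Iu).
- exact: P_para.
- by rewrite P_prod // monic_prod_XsubC.
- by rewrite P_prod // size_prod_XsubC size_iota subn1.
- rewrite P_prod // (rest_polyE n_gt1 (phi_prev Iu)) !hornerM !hornerXsubC.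
  by rewrite subrr mul0r mulr0.
Qed.

(** The velocity equation, multiplied by the constant kappa that makes
    P conj(z R) real. This constant also supplies the factor 1 - zeta / e0 that
    turns <(z - e0) R, z R> into A, the squared norm of (z - e0) R. *)
Lemma integral_pkernel_eq t : I t ->
  exists2 A : R, 0 < A &
  derive1 (phi n) t * A = dt_integral mu w gamma omega E (pkernel theta0 n phi t) t /\
  \int[nu t]_(theta in D) pkernel theta0 n phi t theta = 0.
Proof.
move=> It; have Jt := IJ It.
pose e0 := expi theta0; pose Q u := rest_poly n phi u.
pose z := zeta t; pose V := ('X - e0%:P) * Q t.
have e1 : `|e0| = 1 by exact: norm_expi.
have z1 : `|z| = 1 by rewrite /z zetaE // norm_expi.
have PQ u : I u -> P u = ('X - (zeta u)%:P) * (('X - e0%:P) * Q u).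
  by move=> Iu; rewrite P_prod // zetaE // (rest_polyE n_gt1 (phi_prev Iu)).
have sQ u : (size (Q u) < n)%N.
  by rewrite /Q (size_rest_poly _ _ n_gt1) ltn_predL ltnW.
have dphi := derivable_is_derive1 (derivable_phi It).
set d := derive1 (phi n) t in dphi *.
have dz : is_cderive zeta t ((0 +i* 1) * d%:C * z).
  rewrite /z zetaE //; apply: is_cderive_near (is_cderive_expi dphi).
  by apply: filterS (near_open I_open It) => u Iu; rewrite zetaE.
have near_t : \near t, [/\ P t = ('X - (zeta t)%:P) * (('X - e0%:P) * Q t),
    `|zeta t| = 1, size (P t) = n.+1, (size (Q t) < n)%N &
    paraorth theta0 (nu t) n (P t)].
  apply: filterS (near_open I_open It) => u Iu; split; [exact: PQ| | |exact: sQ|exact: P_para].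
    by rewrite zetaE // norm_expi.
  by rewrite P_prod // size_prod_XsubC size_iota subn1.
have eq1 := velocity_equation J_open gamma_diff omega_diff regE Jt e1 dz
  (fun k => P_coef_diff k It) near_t.
have orth : inner (nu t) D (P t) ('X * Q t) = 0.
  exact: (paraorth_mulX (P_para It)).
have eq2 : (1 - z / e0) * inner (nu t) D V ('X * Q t) = inner (nu t) D V V.
  by apply: velocity_denominator => //; rewrite -PQ.
have Q0 : Q t != 0 by rewrite -size_poly_gt0 (size_rest_poly _ _ n_gt1) -ltnS prednK ?n_gt1 // ltnW.
have V0 : V != 0 by rewrite mulf_neq0 // polyXsubC_eq0.
exists (complex.Re (inner (nu t) D V V)); first exact: (inner_self_gt0 (nu_inf Jt) V0).
pose kappa : R[i] := (0 +i* 1) * (z - e0) / (z * e0).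
pose f theta := (P t).[expi theta] * conjc ('X * Q t).[expi theta].
have fE theta : kappa * f theta = (pkernel theta0 n phi t theta)%:C.
  by rewrite -(pkernel_poly n_gt1 (phi_prev It)) /kappa /f /z zetaE // P_prod.
have hf : cbdiff f by exact: cbdiff_inner.
split.
  have := cdt_integralZ J_open gamma_diff omega_diff regE kappa Jt hf.
  rewrite eq1 => eq3.
  transitivity (complex.Re (d%:C * inner (nu t) D V V)).
    by rewrite cReM /= mul0r subr0.
  rewrite -eq2 (_ : d%:C * _ = kappa * ((0 +i* 1) * d%:C * z * inner (nu t) D V ('X * Q t))).
    rewrite -eq3 /cdt_integral /=; congr (dt_integral _ _ _ _ _ _ _).
    by apply/funext => x; rewrite fE.
  have II : (0 +i* 1) * (0 +i* 1) = -1 :> R[i].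
    by apply: complex_ext; rewrite !ReImE /=; ring.
  have z0 := norm1_neq0 z1; have e00 := norm1_neq0 e1.
  rewrite /kappa; move: (inner _ _ _ _) (0 +i* 1 : R[i]) II => B i II.
  transitivity (- (i * i) * (d%:C * ((1 - z / e0) * B))); first by rewrite II opprK mul1r.
  by field; rewrite z0 e00.
have : complex.Re (cintegral (nu t) D (fun x => kappa * f x)) = 0.
  by rewrite (cintegralZ _ mD) // -innerE orth mulr0.
rewrite /cintegral /= => <-; apply: eq_Rintegral => x _; by rewrite fE.
Qed.

(** The kernel has integral zero. Subtracting c times this integral, with c the
    logarithmic derivative of the weight at the moving zero, turns the derivative
    of the integral into the quantities W and W_j. *)
Lemma velocity_formula t : I t ->
  exists2 A : R, 0 < A & derive1 (phi n) t * A =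
    \int[mu]_(theta in E) (absP2 n phi t theta * W theta0 n w phi theta t * fine (w theta t))
    + \sum_(j < N.+1) absP2 n phi t (omega j t) * Wmass theta0 n w gamma omega phi j t.
Proof.
move=> It; have Jt := IJ It; have [A A0 [eA eL]] := integral_pkernel_eq It.
have [[mE ED] ialpha hE iw formula] := regE.
exists A => //; rewrite eA /dt_integral.
set k := pkernel theta0 n phi t in eL *.
have bk : bdiff k := bdiff_pkernel n_gt1 (phi_prev It).
have bmk := bdiff_bounded_measurable bk.
set c := logdt_weight w (phi n t) t.
move: eL; rewrite (formula t Jt k bmk) => eL.
have eL' := mulr0 c; rewrite -{1}eL in eL'.
rewrite -[LHS]subr0 -[X in _ - X]eL' mulrDr opprD addrACA; congr (_ + _).
  have iwk := bounded_mul_integrable mE (iw t Jt) bmk.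
  have idk := bounded_mul_integrable mE (integrable_dt_weight J_open regE Jt) bmk.
  rewrite -RintegralZl // -RintegralB //; last first.
    exact: (bounded_mul_integrable mE iwk (bounded_measurable_cst _ c)).
  apply: eq_Rintegral => x; rewrite inE => Ex.
  rewrite (dt_weightE J_open regE Ex Jt) /k (pkernelE n_gt1 (phi_prev It)) /W -/c.
  by ring.
rewrite mulr_sumr -sumrB; apply: eq_bigr => j _.
have h := absP2_poly (P_prod It) (@mass_nonzero t j It).
have [_ dk] := is_derive_pkernel n_gt1 (phi_prev It) h.
have dk' : derive1 k (omega j t) = - (k (omega j t) * S_ n phi (omega j t) t).
  by rewrite derive1E; exact: dk.
rewrite dk' /k (pkernelE n_gt1 (phi_prev It)) /Wmass -/c; ring.
Qed.

Hypothesis phi_args : forall t k, I t -> (1 <= k <= n)%N -> args theta0 (phi k t).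

Lemma s_theta0 t : s_ theta0 n phi theta0 t = 0.
Proof. by rewrite /s_ subrr mul0r sin0 mulr0 invr0 mulr0. Qed.

Lemma W_phi t : W theta0 n w phi (phi n t) t = 0.
Proof. by rewrite /W subrr mulr0. Qed.

Lemma args_itv theta : D theta -> theta <> theta0 ->
  theta \in `]theta0, theta0 + 2 * pi[.
Proof.
rewrite /args /= !in_itv /= => /andP[h ->] /eqP ne; rewrite andbT lt_neqAle h andbT.
by rewrite eq_sym.
Qed.

(** The contribution of the variation of the weight at theta to the velocity. *)
Definition weight_work t (theta : R) : R :=
  absP2 n phi t theta * W theta0 n w phi theta t * fine (w theta t).

Lemma integrable_weight_work t : I t -> mu.-integrable E (EFin \o weight_work t).
Proof.
move=> It; have Jt := IJ It; have [[mE ED] ialpha hE iw formula] := regE.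
pose k := pkernel theta0 n phi t; pose c := logdt_weight w (phi n t) t.
have bmk : bounded_measurable k.
  exact: bdiff_bounded_measurable (bdiff_pkernel n_gt1 (phi_prev It)).
have iwk := bounded_mul_integrable mE (iw t Jt) bmk.
have idk := bounded_mul_integrable mE (integrable_dt_weight J_open regE Jt) bmk.
have ick := bounded_mul_integrable mE iwk (bounded_measurable_cst _ c).
apply: (@eq_integrable _ _ _ mu E mE _ _ _ (integrableB mE idk ick)).
move=> x; rewrite inE => Ex; rewrite /= -EFinB; congr (_%:E).
rewrite (dt_weightE J_open regE Ex Jt) /k (pkernelE n_gt1 (phi_prev It)).
by rewrite /weight_work /W -/c; ring.
Qed.

Section Increasing.
Variable t : R.
Hypothesis It : I t.
Hypothesis mono : {in `]theta0, theta0 + 2 * pi[ &, forall theta1 theta2,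
  theta1 <= theta2 -> logdt_weight w theta1 t <= logdt_weight w theta2 t}.

Lemma W_ge0 theta : D theta -> 0 <= W theta0 n w phi theta t.
Proof.
move=> Dx; have [->|/eqP x0] := eqVneq theta theta0.
  by rewrite /W s_theta0 mul0r.
have [->|/eqP xp] := eqVneq theta (phi n t); first by rewrite W_phi.
have hx := args_itv Dx x0; have hp := phi_arc It.
have [_] := s_weight_sign (fun x => logdt_weight w x t) hp hx xp.
by apply => h; apply: mono => //; exact: ltW.
Qed.

Lemma weight_work_ge0 theta : E theta -> 0 <= weight_work t theta.
Proof.
move=> Ex; have [[_ ED] _ hE _ _] := regE; have [w0 _ _] := hE theta t Ex (IJ It).
apply: mulr_ge0 w0; apply: mulr_ge0; first exact: absP2_ge0.
exact: W_ge0 (ED _ Ex).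
Qed.

(** Otherwise the weight would vanish almost everywhere off the zeros of P, and
    the measure would live on these zeros and on the mass points. *)
Lemma weight_work_integral_gt0 :
  {in `]theta0, theta0 + 2 * pi[ &, forall theta1 theta2,
    theta1 < theta2 -> logdt_weight w theta1 t < logdt_weight w theta2 t} ->
  0 < \int[mu]_(theta in E) weight_work t theta.
Proof.
move=> strict; have Jt := IJ It; have [[mE ED] ialpha hE iw formula] := regE.
rewrite lt_neqAle Rintegral_ge0 ?andbT; last exact: weight_work_ge0.
apply/eqP => /esym i0.
have ip := integrable_weight_work It.
have : (\int[mu]_(x in E) `|(weight_work t x)%:E| = 0)%E.
  transitivity (\int[mu]_(x in E) (EFin \o weight_work t) x)%E.
    apply: eq_integral => x; rewrite inE => Ex.
    by rewrite gee0_abs // lee_fin weight_work_ge0.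
  by rewrite -(fineK (integrable_fin_num mE ip)); congr (_%:E).
move/(ae_eq_integral_abs mu mE (measurable_int mu ip)) => ae0.
pose s := [seq phi k t | k <- index_iota 1 n.+1] ++ [seq omega j t | j <- enum 'I_N.+1].
pose A : set (measurableTypeR R) := D `\` [set` s].
have mA : measurable A by exact: measurableD mD (measurable_seq s).
have bA : bounded_measurable (\1_A : measurableTypeR R -> R).
  exact: bounded_measurable_indic.
have := formula t Jt (\1_A) bA.
rewrite [X in _ = _ + X -> _]big1 => [|j _]; last first.
  rewrite indicE memNset ?mulr0 // => -[_]; apply.
  by rewrite /= mem_cat map_f ?orbT // mem_enum.
have -> : \int[mu]_(x in E) (\1_A x * fine (w x t)) = 0.
  rewrite /Rintegral (@ae_eq_integral _ _ _ mu E (cst 0%E)) ?integral0 //.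
    exact: measurable_int (bounded_mul_integrable mE (iw t Jt) bA).
  apply: filterS ae0 => x /= hx Ex; have {hx} := hx Ex.
  case=> px; congr (_%:E); rewrite indicE; case: (boolP (x \in A)) => xA; last by rewrite mul0r.
  move: xA; rewrite inE => -[Dx xs]; rewrite mul1r.
  have xk k : (1 <= k <= n)%N -> phi k t <> x.
    move=> kn e; apply: xs; rewrite /= mem_cat -e map_f //.
    by rewrite mem_index_iota ltnS.
  have n1 : (1 <= n <= n)%N by rewrite leqnn andbT ltnW.
  have n2 : (1 <= n.-1 <= n)%N by rewrite leq_pred andbT -ltnS (prednK (ltnW n_gt1)).
  have P0 : 0 < absP2 n phi t x.
    apply: absP2_gt0 => k kn; apply: (@sin_half_neq0 R theta0) => //.
      exact: phi_args.
    exact: xk.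
  have x0 : x <> theta0 by move=> e; apply: (xk _ n2); rewrite (phi_prev It).
  have xp : x <> phi n t by move=> e; apply: (xk _ n1).
  have W0 : 0 < W theta0 n w phi x t.
    have hx := args_itv Dx x0; have hp := phi_arc It.
    have [h _] := s_weight_sign (fun x => logdt_weight w x t) hp hx xp.
    by apply: h => h; apply: strict.
  move/eqP: px; rewrite /weight_work mulf_eq0 mulf_eq0 (gt_eqF P0) (gt_eqF W0) /=.
  by move/eqP.
rewrite addr0 /Rintegral (integral_indic _ mD) // => fA.
apply: (nu_inf Jt); apply: (@finite_point_massesP _ _ _ s).
have -> : D `\` [set` s] = A `&` D by apply/esym/setIidPl => x [].
rewrite -[LHS]fineK ?fA //; apply: fin_num_measure; exact: measurableI mA mD.
Qed.

Lemma velocity_gt0 :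
  (forall j, 0 <= Wmass theta0 n w gamma omega phi j t) ->
  ({in `]theta0, theta0 + 2 * pi[ &, forall theta1 theta2,
     theta1 < theta2 -> logdt_weight w theta1 t < logdt_weight w theta2 t}
   \/ exists j, 0 < Wmass theta0 n w gamma omega phi j t) ->
  0 < derive1 (phi n) t.
Proof.
move=> Wm strict.
have [A A0 e] := velocity_formula It.
rewrite -(pmulr_lgt0 _ A0) e.
have P0 j : 0 < absP2 n phi t (omega j t).
  by apply: absP2_gt0; exact: (absP2_poly (P_prod It) (@mass_nonzero t j It)).
have sge0 : 0 <= \sum_(j < N.+1) absP2 n phi t (omega j t) *
    Wmass theta0 n w gamma omega phi j t.
  by apply: sumr_ge0 => j _; rewrite mulr_ge0 // ltW.
case: strict => [strict|[j Wj]].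
  by rewrite ltr_wpDr //; exact: weight_work_integral_gt0.
rewrite ltr_wpDl //; first by apply: Rintegral_ge0; exact: weight_work_ge0.
rewrite (bigD1 j) //= ltr_wpDr //; last by rewrite mulr_gt0.
by apply: sumr_ge0 => i _; rewrite mulr_ge0 // ltW.
Qed.

End Increasing.

Lemma velocity_eq0 t : I t ->
  (forall theta, theta \in `]theta0, theta0 + 2 * pi[ ->
     theta <> phi n t -> W theta0 n w phi theta t = 0) ->
  (forall j, Wmass theta0 n w gamma omega phi j t = 0) -> derive1 (phi n) t = 0.
Proof.
move=> It hW hm.
have [A A0 e] := velocity_formula It.
have [[mE ED] _ _ _ _] := regE.
apply: (mulIf (lt0r_neq0 A0)); rewrite mul0r e big1 => [|j _]; last by rewrite hm mulr0.
rewrite addr0 (_ : \int[mu]_(x in E) _ = \int[mu]_(x in E) 0).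
  by rewrite Rintegral_cst // mul0r.
apply: eq_Rintegral => x; rewrite inE => /ED Dx.
have [->|/eqP x0] := eqVneq x theta0; first by rewrite /W s_theta0 mul0r mulr0 mul0r.
have [->|/eqP xp] := eqVneq x (phi n t); first by rewrite W_phi mulr0 mul0r.
by rewrite hW ?mulr0 ?mul0r //; exact: args_itv.
Qed.

End Velocity.

(** * From the velocity to the motion *)

Section Monotonicity.
Variables (R : realType) (t0 eps : R).

Lemma I_itv (a b u : R) : I_ eps t0 a -> I_ eps t0 b -> u \in `[a, b] -> I_ eps t0 u.
Proof.
rewrite /I_ /= !ltr_norml in_itv /= => /andP[a1 a2] /andP[b1 b2] /andP[au ub].
by apply/andP; split; lra.
Qed.

Lemma open_I : open (I_ eps t0).
Proof.
rewrite (_ : I_ eps t0 = ball t0 eps).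
  have [e0|e0] := ltP 0 eps; first exact: ball_open.
  rewrite (_ : ball t0 eps = set0); first exact: open0.
  by apply/seteqP; split => // u; rewrite /ball /= => h;
    have := le_lt_trans (normr_ge0 _) h; rewrite ltNge e0.
by apply/seteqP; split => u; rewrite /I_ /ball /= distrC.
Qed.

Variable f : R -> R.
Hypothesis f_diff : forall t, I_ eps t0 t -> derivable f t 1.

Lemma continuous_on_I : {within I_ eps t0, continuous f}.
Proof.
apply: continuous_in_subspaceT => t; rewrite inE => It.
exact: differentiable_continuous ((derivable1_diffP _ _).1 (f_diff It)).
Qed.

Lemma continuous_on_sub (a b : R) : I_ eps t0 a -> I_ eps t0 b ->
  {within `[a, b], continuous f}.
Proof.
move=> Ia Ib; apply: derivable_within_continuous => u /(I_itv Ia Ib).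
exact: f_diff.
Qed.

Lemma increasing_on_I : (forall t, I_ eps t0 t -> 0 < derive1 f t) ->
  forall a b, I_ eps t0 a -> I_ eps t0 b -> a < b -> f a < f b.
Proof.
move=> f0 a b Ia Ib ab.
have sub u : u \in `]a, b[ -> I_ eps t0 u.
  by move=> /subset_itv_oo_cc; exact: I_itv Ia Ib.
apply: (@gtr0_derive1_incr R f a b) => //.
- by move=> u /sub; exact: f_diff.
- by move=> u /sub; exact: f0.
- exact: continuous_on_sub.
Qed.

Lemma constant_on_I : (forall t, I_ eps t0 t -> derive1 f t = 0) ->
  forall a b, I_ eps t0 a -> I_ eps t0 b -> f a = f b.
Proof.
move=> f0.
suff H a b : I_ eps t0 a -> I_ eps t0 b -> a < b -> f a = f b.
  by move=> a b Ia Ib; have [/H->|/H->|->] := ltgtP a b.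
move=> Ia Ib ab.
have sub u : u \in `]a, b[ -> I_ eps t0 u.
  by move=> /subset_itv_oo_cc; exact: I_itv Ia Ib.
have [c cab] := @MVT R f (derive1 f) a b ab
  (fun u hu => derivable_is_derive1 (f_diff (sub u hu))) (continuous_on_sub Ia Ib).
by rewrite f0 ?mul0r; [move/subr0_eq|exact: sub].
Qed.

End Monotonicity.

Unset Implicit Arguments.

Theorem theorem2p3 (R : realType) (J : set R) (t0 theta0 : R) (N : nat)
  (mu : {measure set (measurableTypeR R) -> \bar R})
  (w : R -> R -> \bar R) (gamma omega : 'I_N.+1 -> R -> R)
  (nu : R -> {finite_measure set (measurableTypeR R) -> \bar R})
  (alpha : R -> R)
  (n : nat) (Q : R -> nat -> {poly R[i]}) (b : R -> R[i])
  (P : R -> {poly R[i]}) (z0 : R[i])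
  (J_open : open J) (J_itv : is_interval J) (J_t0 : J t0)
  (* the weight and the mass points *)
  (w_meas : forall t, J t -> measurable_fun (args theta0)
              (fun theta : measurableTypeR R => w theta t))
  (w_ge0 : forall theta t, args theta0 theta -> J t -> (0 <= w theta t)%E)
  (omega_arc : forall j t, J t -> args theta0 (omega j t))
  (omega_inj : forall t, J t -> injective (fun j => omega j t))
  (* the measure d mu(theta; t) *)
  (nuE : forall t, J t ->
     forall A : set (measurableTypeR R), measurable A ->
       nu t A = (\int[mu]_(theta in A `&` args theta0) w theta t
                 + \sum_(j < N.+1) (gamma j t)%:E * \d_(omega j t) A)%E)
  (nu_inf : forall t, J t -> ~ finite_point_masses (nu t) (args theta0))
  (gamma_diff : forall j t, J t -> derivable (gamma j) t 1)
  (omega_diff : forall j t, J t -> derivable (omega j) t 1)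
  (w_diff : {ae mu, forall theta, args theta0 theta -> forall t, J t ->
     w theta t \is a fin_num /\ derivable (fun u => fine (w theta u)) t 1})
  (alpha_int : mu.-integrable (args theta0) (fun theta => (alpha theta)%:E))
  (w_dom : {ae mu, forall theta, args theta0 theta -> forall t, J t ->
     `|dt_weight w theta t| <= alpha theta})
  (* the paraorthogonal polynomial *)
  (Q_opuc : forall t, J t -> monic_OPUC (nu t) (args theta0) (Q t))
  (b_circle : forall t, J t -> `|b t| = 1)
  (n_gt0 : (0 < n)%N)
  (P_popuc : forall t, J t -> P t = POPUC n (Q t) (b t))
  (P_z0 : (P t0).[z0] = 0) :
  (* (1) *)
  ((forall t, J t -> cderivable b t) ->
   exists eps delta : R, [/\ 0 < eps, 0 < delta, I_ eps t0 `<=` J &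
     exists zeta : R -> R[i], unique_zero_function P t0 z0 eps delta zeta])
  /\
  (* (2) *)
  (forall (eps delta : R) (zeta : R -> R[i]) (phi : nat -> R -> R),
     0 < eps -> 0 < delta -> I_ eps t0 `<=` J ->
     unique_zero_function P t0 z0 eps delta zeta ->
     (forall t, I_ eps t0 t -> (P t).[expi theta0] = 0) ->
     z0 <> expi theta0 ->
     zero_arguments P (I_ eps t0) theta0 n phi ->
     (forall t, I_ eps t0 t -> phi n.-1 t = theta0) ->
     (forall t, I_ eps t0 t -> zeta t = expi (phi n t)) ->
     (* every W_j is well defined: no mass point is a zero of P *)
     (forall t j, I_ eps t0 t -> (P t).[expi (omega j t)] <> 0) ->
     ((forall t, I_ eps t0 t ->
         [/\ {in `]theta0, theta0 + 2 * pi[ &, forall theta1 theta2,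
               theta1 <= theta2 ->
               logdt_weight w theta1 t <= logdt_weight w theta2 t},
             (forall j, 0 <= Wmass theta0 n w gamma omega phi j t) &
             {in `]theta0, theta0 + 2 * pi[ &, forall theta1 theta2,
               theta1 < theta2 ->
               logdt_weight w theta1 t < logdt_weight w theta2 t}
             \/ exists j, 0 < Wmass theta0 n w gamma omega phi j t]) ->
      moves_strictly_counterclockwise (I_ eps t0) zeta (phi n))
     /\
     ((forall t, I_ eps t0 t ->
         (forall theta, theta \in `]theta0, theta0 + 2 * pi[ ->
            theta <> phi n t -> W theta0 n w phi theta t = 0) /\
         (forall j, Wmass theta0 n w gamma omega phi j t = 0)) ->
      does_not_move (I_ eps t0) zeta)).
Proof.
have [E regE] := exists_regular_set w_meas w_ge0 omega_arc nuE w_diff alpha_int w_dom.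
have paraP t : J t -> paraorth theta0 (nu t) n (P t).
  by move=> Jt; rewrite P_popuc //; exact: popuc_paraorth (Q_opuc t Jt) n_gt0.
have monP t : J t -> P t \is monic.
  by move=> Jt; rewrite P_popuc //; exact: popuc_monic (Q_opuc t Jt) n_gt0.
have sizeP t : J t -> size (P t) = n.+1.
  by move=> Jt; rewrite P_popuc //; exact: popuc_size (Q_opuc t Jt) n_gt0.
have circP t z : J t -> (P t).[z] = 0 -> `|z| = 1.
  move=> Jt; rewrite P_popuc //.
  exact: (popuc_roots_circle (Q_opuc t Jt) (b_circle t Jt) n_gt0 (nu_inf t Jt)).
have simpP t z r : J t -> `|z| = 1 -> P t <> ('X - z%:P) * ('X - z%:P) * r.
  move=> Jt; rewrite P_popuc //.
  exact: (popuc_simple (Q_opuc t Jt) n_gt0 (nu_inf t Jt)).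
split=> [b_diff|eps delta zeta phi eps0 delta0 IJ [[zt0 hzeta] _] Pe0 z0e0 zargs phi_prev zetaE massP].
  apply: (@simple_zero_function R P n J) => //.
  move=> t k Jt.
  (* P(0) = - conj b provides the equation that determines P *)
  apply: (@cderivable_paraorth_coef R theta0 nu P n 0 (fun u => - conjc (b u))) => //.
  - by rewrite normr0 ler01.
  - move=> i j; apply/cderivableP; eexists.
    exact: (cderive_moment J_open gamma_diff omega_diff regE 'X^i 'X^j Jt).
  - exact: cderivableN (cderivable_conjc (b_diff t Jt)).
  have : \forall u \near t, J u by exact: open_nbhs_nbhs.
  apply: filterS => u Ju; split; [exact: nu_inf|exact: paraP|exact: monP|exact: sizeP|].
  by rewrite P_popuc //; exact: popuc_horner0 (Q_opuc u Ju).
have It0 : I_ eps t0 t0 by rewrite /I_ /= subrr normr0.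
have Pprod t (It : I_ eps t0 t) := (zargs t It).2.
have phi_args t k : I_ eps t0 t -> (1 <= k <= n)%N -> args theta0 (phi k t).
  by move=> It; have [h _] := zargs t It; exact: h.
(* a polynomial of degree 1 cannot vanish at both z0 and e^(i theta0) *)
have n_gt1 : (1 < n)%N.
  rewrite ltnNge; apply/negP => n1; apply: z0e0.
  have n1' : n = 1%N by apply/eqP; rewrite eqn_leq n1.
  have := Pprod t0 It0; rewrite n1' big_nat1 => e.
  have := P_z0; have := Pe0 t0 It0; rewrite e !hornerXsubC.
  by move=> /subr0_eq -> /subr0_eq ->.
have phi_arc t : I_ eps t0 t -> phi n t \in `]theta0, theta0 + 2 * pi[.
  move=> It; apply: args_itv; first by apply: phi_args => //; rewrite leqnn andbT ltnW.
  move=> e; apply: (simpP t (expi theta0) (rest_poly n phi t) (IJ t It) (norm_expi _)).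
  by rewrite Pprod // (rest_polyE n_gt1 (phi_prev t It)) e mulrA.
have I_open : open (I_ eps t0) by exact: open_I.
have zeta_diff t : I_ eps t0 t -> cderivable zeta t by move=> /hzeta[].
have paraI t : I_ eps t0 t -> paraorth theta0 (nu t) n (P t).
  by move=> It; exact: paraP (IJ t It).
have phi_diff t : I_ eps t0 t -> derivable (phi n) t 1.
  exact: (derivable_phi I_open phi_arc zetaE zeta_diff).
split=> [incr|still].
  split; [exact: continuous_on_I|exact: zetaE|].
  apply: increasing_on_I => // t It; have [mono Wm strict] := incr t It.
  exact: (velocity_gt0 J_open gamma_diff omega_diff regE nu_inf I_open IJ n_gt1
    paraI Pprod phi_prev phi_arc zetaE zeta_diff massP phi_args It mono Wm strict).
move=> t u It Iu; rewrite !zetaE //; congr expi.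
apply: (constant_on_I phi_diff) It Iu => v Iv; have [hW hm] := still v Iv.
exact: (velocity_eq0 J_open gamma_diff omega_diff regE nu_inf I_open IJ n_gt1
  paraI Pprod phi_prev phi_arc zetaE zeta_diff massP Iv hW hm).
Qed.
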